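(* The family $\mathcal F(\text{2CC})=\{\text{2CC}_n\}_{n\ge2}$ is a complete and universal family for $\Sigma_2^p$.
   Context: $\text{2CC}$ is the set of finite simple graphs (structures over $\sigma_g=\langle E^2\rangle$ with universe $\{0,\dots,m-1\}$, $E$ symmetric and irreflexive) admitting a 2-coloring of the vertices with no monochromatic maximal clique. For a problem $S$ over $\sigma$, $S_n:=S\cup\{\mathcal A\in\mathrm{STRUC}[\sigma]:\|\mathcal A\|<n\}$ and $\mathcal F(S):=\{S_n\}_{n\ge2}$. $\Sigma_2^p$: problems MOD$[\Phi]$ with $\Phi$ of the form $\exists\vec R_1\forall\vec R_2\,\varphi$, $\varphi$ first order (numeric symbols $\le$, BIT, PLUS, TIMES, SUC, $0,1,\max$ available with standard meaning). Completeness is with respect to first-order projections (fops): quantifier-free-style first-order interpretations $\mathcal A\mapsto I(\mathcal A)$ whose universe formula is numeric and whose defining formulas have the form $\alpha_0\vee(\alpha_1\wedge\lambda_1)\vee\dots\vee(\alpha_\ell\wedge\lambda_\ell)$ with $\alpha_t$ numeric mutually exclusive and $\lambda_t$ literals of the input vocabulary; $B$ is $\Sigma_2^p$-complete if $B\in\Sigma_2^p$ and every $A\in\Sigma_2^p$ reduces to $B$ by a fop. Universality (graph vocabulary): a conjunction $\bigwedge_{j=1}^tL_j(u_j,v_j)$ with $L_j\in\{E,\neg E\}$ and $u_j,v_j\in\{0,\dots,m-1\}$ is $m$-consistent if some simple graph on $\{0,\dots,m-1\}$ satisfies it, and $m$-consistent in $S$ if some member of $S$ of size $m$ does; $S$ is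 $(n,t)$-universal if for all $m\ge n$ every $m$-consistent such conjunction of $t$ literals is $m$-consistent in $S$. A family $\mathcal F$ of problems over $\sigma$ is complete and universal for a class $\mathbf C$ if (1) every problem in $\mathcal F$ is $\mathbf C$-complete, and (2) there are a sequence $\{n_k\}_{k\ge0}$ and a natural number $m$ such that for every $k\ge m$ there is an $(n_k,k)$-universal problem in $\mathcal F$ containing all $\sigma$-structures $\mathcal A$ with $\|\mathcal A\|<n_k$. *)

(* Defs.v *)
From HB Require Import structures.
From mathcomp Require Import all_boot all_order.

Set Implicit Arguments.
Unset Strict Implicit.
Unset Printing Implicit Defensive.

Record vocabulary : Type := Vocabulary {
  rsym : finType;
  arity : rsym -> nat;
  csym : finType }.

Record structure (s : vocabulary) (m : nat) : Type := Structure {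
  srel : forall r : rsym s, {set (arity r).-tuple 'I_m};
  scst : csym s -> 'I_m }.

(* As usual in descriptive complexity, universes have at least two elements
   (so that 0 and 1 differ): the members of STRUC[s] of size m >= 2 are the
   elements of [structure s m], and m is written [n.+2] throughout. *)
Definition problem (s : vocabulary) : Type :=
  forall n : nat, structure s n.+2 -> Prop.

Inductive term (s : vocabulary) (k : nat) : Type :=
| TVar of 'I_k
| TCst of csym s
| TZero
| TOne
| TMax.
Arguments TVar {s k} _.
Arguments TCst {s k} _.
Arguments TZero {s k}.
Arguments TOne {s k}.
Arguments TMax {s k}.

(* [formula s k]: formulas whose free variables are among x_0, ..., x_(k-1).
   A quantifier binds x_0 of its body and shifts the other variables. *)
Inductive formula (s : vocabulary) : nat -> Type :=
| FRel k (r : rsym s) of (arity r).-tuple (term s k) : formula s k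
| FEq k of term s k & term s k : formula s k
| FLe k of term s k & term s k : formula s k
| FSuc k of term s k & term s k : formula s k
| FBit k of term s k & term s k : formula s k
| FPlus k of term s k & term s k & term s k : formula s k
| FTimes k of term s k & term s k & term s k : formula s k
| FNot k of formula s k : formula s k
| FAnd k of formula s k & formula s k : formula s k
| FOr k of formula s k & formula s k : formula s k
| FExists k of formula s k.+1 : formula s k
| FForall k of formula s k.+1 : formula s k.
Arguments FRel {s k} r _.

Definition teval (s : vocabulary) (n : nat) (A : structure s n.+2) (k : nat)
    (e : k.-tuple 'I_n.+2) (t : term s k) : 'I_n.+2 :=
  match t with
  | TVar i => tnth e i
  | TCst c => scst A c
  | TZero => ord0
  | TOne => inord 1
  | TMax => ord_max
  end.

(* BIT(i, j): the bit of weight 2^j in the binary expansion of i is 1. *)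
Fixpoint sat (s : vocabulary) (n : nat) (A : structure s n.+2) (k : nat)
    (phi : formula s k) {struct phi} : k.-tuple 'I_n.+2 -> bool :=
  match phi in formula _ k return k.-tuple 'I_n.+2 -> bool with
  | FRel _ r ts => fun e => [tuple of map (teval A e) ts] \in srel A r
  | FEq _ t u => fun e => teval A e t == teval A e u
  | FLe _ t u => fun e => teval A e t <= teval A e u
  | FSuc _ t u => fun e => (teval A e t).+1 == teval A e u :> nat
  | FBit _ t u => fun e => odd (teval A e t %/ 2 ^ teval A e u)
  | FPlus _ t u v => fun e => teval A e t + teval A e u == teval A e v :> nat
  | FTimes _ t u v => fun e => teval A e t * teval A e u == teval A e v :> nat
  | FNot _ f => fun e => ~~ sat A f e
  | FAnd _ f g => fun e => sat A f e && sat A g e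
  | FOr _ f g => fun e => sat A f e || sat A g e
  | FExists _ f => fun e => [exists x, sat A f [tuple of x :: e]]
  | FForall _ f => fun e => [forall x, sat A f [tuple of x :: e]]
  end.

(* [s] with additional relation symbols, of arities [a`_0, a`_1, ...] *)
Definition ext_voc (s : vocabulary) (a : seq nat) : vocabulary :=
  @Vocabulary (rsym s + 'I_(size a))%type
    (fun r => match r with inl r => arity r | inr i => nth 0 a i end)
    (csym s).

Definition relations (a : seq nat) (m : nat) : Type :=
  forall i : 'I_(size a), {set (nth 0 a i).-tuple 'I_m}.

Definition expand (s : vocabulary) (m : nat) (A : structure s m) (a : seq nat)
    (X : relations a m) : structure (ext_voc s a) m :=
  @Structure (ext_voc s a) m
    (fun r => match r with inl r => srel A r | inr i => X i end)
    (scst A).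

Definition sigma2_models (s : vocabulary) (a1 a2 : seq nat)
    (phi : formula (ext_voc (ext_voc s a1) a2) 0)
    (n : nat) (A : structure s n.+2) : Prop :=
  exists X1 : relations a1 n.+2, forall X2 : relations a2 n.+2,
    sat (expand (expand A X1) X2) phi [tuple].

Definition problem_class : Type := forall s : vocabulary, problem s -> Prop.

Definition Sigma2p : problem_class := fun s S =>
  exists (a1 a2 : seq nat) (phi : formula (ext_voc (ext_voc s a1) a2) 0),
    forall (n : nat) (A : structure s n.+2), S n A <-> sigma2_models phi A.
Arguments Sigma2p : clear implicits.

Definition num_voc : vocabulary :=
  @Vocabulary void (fun r => match r with end) void.

Definition num_structure (m : nat) : structure num_voc m :=
  @Structure num_voc m (fun r => match r with end) (fun c => match c with end).

(* Only numeric symbols: no symbol (relation or constant) of an input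
   vocabulary can occur; quantifiers can. *)
Definition numeric (k : nat) : Type := formula num_voc k.

Definition num_sat (n k : nat) (alpha : numeric k) (e : k.-tuple 'I_n.+2) : bool :=
  sat (num_structure n.+2) alpha e.

(* Atomic formulas over the input vocabulary proper: the arguments are
   variables or constant symbols of [s]. *)
Inductive input_atom (s : vocabulary) (k : nat) : Type :=
| IRel (r : rsym s) of (arity r).-tuple ('I_k + csym s)
| IEq of ('I_k + csym s) & ('I_k + csym s).
Arguments IRel {s k} r _.

Definition ieval (s : vocabulary) (n : nat) (A : structure s n.+2) (k : nat)
    (e : k.-tuple 'I_n.+2) (t : 'I_k + csym s) : 'I_n.+2 :=
  match t with inl i => tnth e i | inr c => scst A c end.

Definition atom_sat (s : vocabulary) (n : nat) (A : structure s n.+2) (k : nat)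
    (a : input_atom s k) (e : k.-tuple 'I_n.+2) : bool :=
  match a with
  | IRel r ts => [tuple of map (ieval A e) ts] \in srel A r
  | IEq t u => ieval A e t == ieval A e u
  end.

(* [(true, a)] is the literal a, [(false, a)] its negation. *)
Definition literal (s : vocabulary) (k : nat) : Type := (bool * input_atom s k)%type.

Definition lit_sat (s : vocabulary) (n : nat) (A : structure s n.+2) (k : nat)
    (l : literal s k) (e : k.-tuple 'I_n.+2) : bool :=
  atom_sat A l.2 e == l.1.

(* alpha_0 \/ (alpha_1 /\ lambda_1) \/ ... \/ (alpha_l /\ lambda_l) *)
Record projective (s : vocabulary) (k : nat) : Type := Projective {
  pbase : numeric k;
  pcases : seq (numeric k * literal s k);
  pexcl : forall (n : nat) (e : k.-tuple 'I_n.+2),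
    count (fun alpha => num_sat alpha e) (pbase :: [seq c.1 | c <- pcases]) <= 1 }.

Definition proj_sat (s : vocabulary) (n : nat) (A : structure s n.+2) (k : nat)
    (p : projective s k) (e : k.-tuple 'I_n.+2) : bool :=
  num_sat (pbase p) e || has (fun c => num_sat c.1 e && lit_sat A c.2 e) (pcases p).

Record fop (s t : vocabulary) : Type := Fop {
  fop_dim : nat;
  fop_univ : numeric fop_dim;
  fop_rel : forall r : rsym t, projective s (arity r * fop_dim);
  fop_cst : forall c : csym t, projective s fop_dim }.

Lemma flatten_tupleP (T : Type) (a d : nat) (u : a.-tuple (d.-tuple T)) :
  size (flatten [seq tval v | v <- u]) == a * d.
Proof.
rewrite size_flatten.
have -> : shape [seq tval v | v <- u] = nseq a d; last by rewrite sumn_nseq mulnC.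
apply: (@eq_from_nth _ 0); rewrite !size_map size_tuple ?size_nseq // => i lt_ia.
rewrite nth_nseq lt_ia (nth_map [::]) ?size_map ?size_tuple //.
by rewrite (nth_map (tnth u (Ordinal lt_ia))) ?size_tuple.
Qed.

(* (u_0, ..., u_(a-1)) seen as u_00, ..., u_0(d-1), u_10, ... *)
Definition flatten_tuple (T : Type) (a d : nat) (u : a.-tuple (d.-tuple T)) :
    (a * d).-tuple T := Tuple (flatten_tupleP u).

(* B = I(A): the universe of I(A), a set of tuples, is identified with
   {0, ..., n+1} by its enumeration [f] in lexicographic order.  Stated as a
   relation because I(A) is only defined when the universe formula selects at
   least two tuples and every constant formula selects exactly one. *)
Definition fop_image (s t : vocabulary) (I : fop s t) (m : nat) (A : structure s m.+2)
    (n : nat) (B : structure t n.+2) : Prop :=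
  exists f : 'I_n.+2 -> (fop_dim I).-tuple 'I_m.+2,
    [/\ forall i j : 'I_n.+2,
          i < j -> ((f i : (fop_dim I).-tuplelexi 'I_m.+2) < f j)%O,
        forall b, num_sat (fop_univ I) b <-> exists i, f i = b,
        forall (r : rsym t) (v : (arity r).-tuple 'I_n.+2),
          (v \in srel B r) =
            proj_sat A (fop_rel I r) (flatten_tuple [tuple of map f v])
      & forall (c : csym t) (i : 'I_n.+2),
          (scst B c == i) = proj_sat A (fop_cst I c) (f i)].

Definition fop_reducible (s t : vocabulary) (S : problem s) (T : problem t) : Prop :=
  exists I : fop s t, forall (m : nat) (A : structure s m.+2),
    exists (n : nat) (B : structure t n.+2),
      fop_image I A B /\ (S m A <-> T n B).

Definition complete (C : problem_class) (t : vocabulary) (T : problem t) : Prop :=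
  C t T /\ forall (s : vocabulary) (S : problem s), C s S -> fop_reducible S T.

Definition graph_voc : vocabulary := @Vocabulary unit (fun=> 2) void.

Definition edge (m : nat) (G : structure graph_voc m) (u v : 'I_m) : bool :=
  [tuple u; v] \in srel G tt.

Definition simple_graph (m : nat) (G : structure graph_voc m) : Prop :=
  symmetric (edge G) /\ irreflexive (edge G).

Definition clique (m : nat) (G : structure graph_voc m) (K : {set 'I_m}) : bool :=
  [forall x in K, forall y in K, (x != y) ==> edge G x y].

(* A one-vertex maximal clique (an isolated vertex) is monochromatic. *)
Definition two_CC : problem graph_voc := fun n G =>
  simple_graph G /\
  exists c : 'I_n.+2 -> bool, forall K : {set 'I_n.+2}, maxset (clique G) K ->
    ~ exists b : bool, forall x, x \in K -> c x = b.
Arguments two_CC : clear implicits.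

(* [(true, u, v)] stands for E(u, v), [(false, u, v)] for its negation. *)
Definition conjunction (m t : nat) : Type := t.-tuple (bool * 'I_m * 'I_m).

Definition models (m t : nat) (G : structure graph_voc m) (L : conjunction m t) : Prop :=
  forall l, l \in L -> edge G l.1.2 l.2 = l.1.1.

Definition consistent_in (m t : nat) (P : structure graph_voc m -> Prop)
    (L : conjunction m t) : Prop :=
  exists G : structure graph_voc m, P G /\ models G L.

Definition universal (S : problem graph_voc) (n t : nat) : Prop :=
  forall m : nat, n <= m.+2 -> forall L : conjunction m.+2 t,
    consistent_in (@simple_graph m.+2) L -> consistent_in (S m) L.

Definition complete_universal (C : problem_class) (F : problem graph_voc -> Prop) : Prop :=
  (forall S, F S -> complete C S) /\
  exists (nn : nat -> nat) (m : nat), forall k : nat, m <= k ->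
    exists S : problem graph_voc,
      [/\ F S,
          universal S (nn k) k
        & forall (n : nat) (A : structure graph_voc n.+2), n.+2 < nn k -> S n A].

Definition add_small (s : vocabulary) (S : problem s) (n : nat) : problem s :=
  fun m A => S m A \/ m.+2 < n.

Definition trunc_family (s : vocabulary) (S : problem s) : problem s -> Prop :=
  fun T => exists2 n : nat, 2 <= n & T = add_small S n.

(* Main.v *)
Require Import Defs.
From mathcomp Require Import all_boot all_order.
From mathcomp Require Import zify.
From HB Require Import structures.

Set Implicit Arguments.
Unset Strict Implicit.
Unset Printing Implicit Defensive.

(* Hardness.  Over assignments of fixed length [D], a second-order sentence
   becomes a circuit of NOR gates (instruction, assignment): reading "gate g is
   the negated disjunction of its children" as a digraph, the consistent
   valuations are its kernels (independent sets meeting g or a child of g, for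
   every g).  A bit of a quantified relation is a pair of gates that are
   children of each other.  The graph has a vertex [Lit] for every gate, two of
   them adjacent unless one is a child of the other, and a vertex [Cla] for every
   gate, adjacent to the [Lit] vertices outside its closed out-neighbourhood;
   a set of [Lit] vertices is a maximal clique iff it is a kernel.  The vertices
   [Aux] and [Ref], lying on edges that are maximal cliques, force all [Lit] to
   have one colour and all [Cla] the other, except that the two [Lit] of a bit of
   an existentially quantified relation get opposite colours.  So a colouring
   chooses the existential relations, and a monochromatic maximal clique is a
   choice of the universal relations and gate values that refutes the sentence.
   The input only decides whether an atom gate has the gate "true" as a child,
   hence each edge depends on at most one literal of the input.

   All tuples of the target dimension are used as vertices: the kind of a vertex
   is decoded from the coordinates that are nonzero, and the resulting
   repetitions are twins, which do not affect colourability. *)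

(** * Clique colourings *)

Definition cliqueb (T : finType) (e : rel T) (K : {set T}) : bool :=
  [forall x in K, forall y in K, (x != y) ==> e x y].

(** Maximality is tested by adding one vertex at a time, so that each vertex outside [K] comes with
    a non-neighbour in [K]; [max_cliqueE] identifies this with inclusion-maximality. *)
Definition max_clique (T : finType) (e : rel T) (K : {set T}) : bool :=
  cliqueb e K && [forall v, (v \notin K) ==> [exists u in K, ~~ e u v]].

Definition clique_colorable (T : finType) (e : rel T) : Prop :=
  exists c : T -> bool, forall K, max_clique e K ->
    exists x y, [/\ x \in K, y \in K, c x & ~~ c y].

Lemma cliqueP (T : finType) (e : rel T) (K : {set T}) :
  reflect {in K &, forall x y, x != y -> e x y} (cliqueb e K).
Proof.
apply: (iffP forall_inP) => [H x y xK yK xy | H x xK].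
  by move/forall_inP: (H x xK) => /(_ y yK) /implyP; apply.
by apply/forall_inP=> y yK; apply/implyP; apply: H.
Qed.

Lemma max_cliqueP (T : finType) (e : rel T) (K : {set T}) :
  reflect ({in K &, forall x y, x != y -> e x y} /\
           forall v, v \notin K -> exists2 u, u \in K & ~~ e u v) (max_clique e K).
Proof.
apply: (iffP andP) => [[/cliqueP H1 /forallP H2] | [H1 H2]]; split => //.
- by move=> v /(implyP (H2 v)) /exists_inP.
- exact/cliqueP.
- by apply/forallP=> v; apply/implyP=> vK; apply/exists_inP; apply: H2.
Qed.

Lemma max_cliqueE (T : finType) (e : rel T) (K : {set T}) :
  symmetric e -> irreflexive e -> maxset (cliqueb e) K = max_clique e K.
Proof.
move=> sym irr; apply/maxsetP/max_cliqueP => [[/cliqueP H1 H2] | [H1 H2]].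
  split=> // v vK; apply/exists_inP; apply: contraR vK => /exists_inPn H.
  rewrite -(H2 (v |: K)) ?setU11 ?subsetU1 //; apply/cliqueP=> x y.
  rewrite !inE => /orP[/eqP->|xK] /orP[/eqP->|yK] xy; first by rewrite eqxx in xy.
  - by rewrite sym; move: (H _ yK); rewrite negbK.
  - by move: (H _ xK); rewrite negbK.
  - exact: H1.
split=> [|B /cliqueP cB KB]; first exact/cliqueP.
apply/eqP; rewrite eqEsubset KB andbT; apply/subsetP=> v vB.
apply/negPn/negP=> vK; case: (H2 v vK) => u uK /negP; apply; apply: cB => //.
  exact: (subsetP KB).
by apply: contraNneq vK => <-.
Qed.

Lemma clique_extend (T : finType) (e : rel T) (K : {set T}) :
  symmetric e -> irreflexive e -> cliqueb e K ->
  exists2 M, max_clique e M & K \subset M.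
Proof.
move=> sym irr /maxset_exists[M maxM KM].
by exists M; rewrite // -max_cliqueE.
Qed.

(** An edge without common neighbours is itself a maximal clique, so both colours must occur at its
    two ends. *)
Lemma edge_bichromatic (T : finType) (e : rel T) (c : T -> bool) (x y : T) :
  symmetric e -> irreflexive e ->
  (forall K, max_clique e K -> exists x y, [/\ x \in K, y \in K, c x & ~~ c y]) ->
  e x y -> (forall z, ~~ (e x z && e y z)) -> c x = ~~ c y.
Proof.
move=> sym irr Hc exy Hz.
have /Hc[u [v [+ + cu cv]]] : max_clique e [set x; y].
  apply/max_cliqueP; split=> [u v|v].
    rewrite !inE => /orP[]/eqP-> /orP[]/eqP->; rewrite ?eqxx //.
    by rewrite sym.
  rewrite !inE => _; move: (Hz v); rewrite negb_and => /orP[] ?.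
    by exists x; rewrite ?inE ?eqxx.
  by exists y; rewrite ?inE ?eqxx ?orbT.
rewrite !inE => /orP[]/eqP uE /orP[]/eqP vE; subst; rewrite ?cu ?(negbTE cv) //.
  by rewrite cu in cv.
by rewrite cu in cv.
Qed.

Lemma eq_clique_colorable (T : finType) (e e' : rel T) :
  e =2 e' -> clique_colorable e -> clique_colorable e'.
Proof.
move=> ee' [c Hc]; exists c => K /max_cliqueP[K1 K2]; apply: Hc.
apply/max_cliqueP; split=> [x y xK yK xy|v /K2[u uK uv]]; first by rewrite ee' K1.
by exists u; rewrite // ee'.
Qed.

(* Replacing every vertex by an independent set of twins does not change
   colorability: a maximal clique picks one twin from each class it meets. *)
Lemma clique_colorable_twins (T T' : finType) (e' : rel T') (f : T -> T') :
  irreflexive e' -> (forall y, exists x, f x = y) ->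
  clique_colorable (fun x y => e' (f x) (f y)) <-> clique_colorable e'.
Proof.
move=> irr surj.
have [g gK] := fin_all_exists surj; split=> -[c Hc].
  exists (c \o g) => K /max_cliqueP[K1 K2].
  have /Hc[u [v [/imsetP[x xK ->] /imsetP[y yK ->] cx cy]]] :
      max_clique (fun x y => e' (f x) (f y)) (g @: K).
    apply/max_cliqueP; split=> [_ _ /imsetP[x xK ->] /imsetP[y yK ->] xy|v vK].
      by rewrite !gK; apply: K1 => //; apply: contraNneq xy => ->.
    (* A twin of a chosen representative is excluded by that representative, since [e'] is
       irreflexive. *)
    have [fvK|/K2[u uK uv]] := boolP (f v \in K).
      by exists (g (f v)); rewrite ?imset_f // gK irr.
    by exists (g u); rewrite ?imset_f // gK.
  by exists x, y.
exists (c \o f) => K /max_cliqueP[K1 K2].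
have /Hc[u [v [/imsetP[x xK ->] /imsetP[y yK ->] cx cy]]] :
    max_clique e' (f @: K).
  apply/max_cliqueP; split=> [_ _ /imsetP[x xK ->] /imsetP[y yK ->] xy|v vK].
    by apply: K1 => //; apply: contraNneq xy => ->.
  have /K2[u uK uv] : g v \notin K.
    by apply: contra vK => gvK; rewrite -(gK v) imset_f.
  by exists (f u); rewrite ?imset_f // -(gK v).
by exists x, y.
Qed.

Lemma two_CC_colorable n (G : structure graph_voc n.+2) :
  two_CC n G <-> simple_graph G /\ clique_colorable (edge G).
Proof.
split=> -[[sym irr] [c Hc]]; split=> //; exists c => K.
  rewrite -max_cliqueE // => /Hc H.
  have [/exists_inP[x xK cx]|/exists_inPn Hx] := boolP [exists x in K, c x]; last first.
    by case: H; exists false => x /Hx/negbTE.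
  have [/exists_inP[y yK cy]|/exists_inPn Hy] := boolP [exists x in K, ~~ c x].
    by exists x, y.
  by case: H; exists true => y /Hy/negPn.
rewrite [maxset _ _]max_cliqueE // => /Hc[x [y [xK yK cx /negP cy]]] [b Hb].
by case: cy; rewrite Hb // -(Hb x).
Qed.

(** * The graph whose clique colourings encode kernels *)

Inductive role := Lit | Aux | Cla | Ref.

Definition bools_of_role (r : role) : bool * bool :=
  match r with
  | Lit => (true, true) | Aux => (true, false)
  | Cla => (false, true) | Ref => (false, false)
  end.

Definition role_of_bools (b : bool * bool) : role :=
  match b with
  | (true, true) => Lit | (true, false) => Aux
  | (false, true) => Cla | (false, false) => Ref
  end.

Lemma bools_of_roleK : cancel bools_of_role role_of_bools.
Proof. by case. Qed.

HB.instance Definition _ := Finite.copy role (can_type bools_of_roleK).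

Section KernelGraph.

Variables (V : finType) (conflict hit : rel V) (ex : pred V) (neg : V -> V) (D : V).

(** [hit c v] reads: the choice of [v] meets the requirement indexed by [c]. Elements of [V] serve
    both as choices and as names of requirements. *)
Definition kernel_adj (x y : role * V) : bool :=
  let: (r, v) := x in let: (q, w) := y in
  match r, q with
  | Lit, Lit => (v != w) && ~~ conflict v w
  | Lit, Cla => ~~ hit w v
  | Cla, Lit => ~~ hit v w
  | Lit, Aux | Aux, Lit => v == w
  | Aux, Aux => ex v && (w == neg v)
  | Aux, Ref => ~~ ex v
  | Ref, Aux => ~~ ex w
  | Cla, Ref | Ref, Cla => true
  | _, _ => false
  end.

(** When [conflict] is the symmetrised arc relation of a digraph and [hit c] the closed
    out-neighbourhood of [c], this is a kernel in the usual sense. *)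
Definition kernel (K : {set V}) : Prop :=
  {in K &, forall v w, ~~ conflict v w} /\
  forall c, exists2 v, v \in K & hit c v.

Hypotheses (conflict_sym : symmetric conflict) (conflict_irr : irreflexive conflict).
Hypotheses (negK : involutive neg) (ex_neg : forall v, ex (neg v) = ex v).
Hypothesis neg_neq : forall v, ex v -> neg v != v.
Hypotheses (D_conflict : forall v, conflict D v = false).
Hypotheses (D_hit : forall c, hit c D = false) (D_ex : ex D = false).
Hypothesis neg_conflict : forall v, ex v -> conflict v (neg v).
Hypothesis neg_hit : forall v, ex v -> forall w, hit v w -> w = v \/ w = neg v.

Lemma kernel_adj_sym : symmetric kernel_adj.
Proof.
move=> [r v] [q w]; case: r; case: q => //=.
  by rewrite eq_sym conflict_sym.
by apply/andP/andP=> -[exv /eqP->]; rewrite ex_neg negK.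
Qed.

Lemma kernel_adj_irr : irreflexive kernel_adj.
Proof.
move=> [r v]; case: r => //=; first by rewrite eqxx.
by apply/negP=> /andP[/neg_neq]; rewrite eq_sym => /negbTE->.
Qed.

(** The colouring is constant on each role, except that the [Lit] and [Aux] vertices of [ex]
    elements follow [chi]. A maximal clique with a [Ref] or [Aux] vertex contains a bichromatic
    edge; any other contains [(Lit, D)], and if monochromatic it would be a kernel on which [chi]
    holds. *)
Lemma colorable_kernel :
  (exists2 chi : V -> bool, (forall v, ex v -> chi (neg v) = ~~ chi v) &
    forall K, kernel K -> ~ (forall v, v \in K -> ex v -> chi v)) ->
  clique_colorable kernel_adj.
Proof.
move=> [chi chiN noK].
pose lit v := if ex v then chi v else true.
exists (fun x => match x.1 with
  | Lit => lit x.2 | Aux => ~~ lit x.2 | Cla => false | Ref => true end) => M.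
move=> /max_cliqueP[M1 M2].
have adjM x y : x \in M -> y \in M -> x <> y -> kernel_adj x y.
  by move=> xM yM /eqP; apply: M1.
have [/existsP[v vM]|noRef] := boolP [exists v, (Ref, v) \in M].
  (* [M] cannot be reduced to its [Ref] vertex, because [(Aux, D)] could be added. *)
  have [[r w] wM nvw] : exists2 x, x \in M & ~~ (~~ kernel_adj x (Ref, v)).
    have [sM|] := boolP (M \subset [set (Ref, v)]).
      have /M2[x xM] : (Aux, D) \notin M.
        by apply/negP=> /(subsetP sM); rewrite !inE.
      by move/(subsetP sM): (xM); rewrite !inE => /eqP->; rewrite /= D_ex.
    case/subsetPn=> x xM; rewrite !inE => /eqP xv; exists x => //.
    by rewrite negbK; apply: adjM.
  exists (Ref, v), (r, w); split=> //.
  by move: nvw; rewrite negbK; case: (r) => //= nexw; rewrite /lit (negbTE nexw).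
have [/existsP[v vM]|noAux] := boolP [exists v, (Aux, v) \in M].
  have [[r w] wM nvw] : exists2 x, x \in M & kernel_adj x (Aux, v).
    have [sM|] := boolP (M \subset [set (Aux, v)]).
      have /M2[x xM] : (Lit, v) \notin M.
        by apply/negP=> /(subsetP sM); rewrite !inE.
      by move/(subsetP sM): (xM); rewrite !inE => /eqP->; rewrite /= eqxx.
    case/subsetPn=> x xM; rewrite !inE => /eqP xv; exists x => //.
    exact: adjM.
  case: r wM nvw => //= wM.
  - move/eqP=> wv; rewrite wv in wM; case E: (lit v).
      by exists (Lit, v), (Aux, v); rewrite /= E.
    by exists (Aux, v), (Lit, v); rewrite /= E.
  - case/andP=> exw /eqP vE.
    have E : lit v = ~~ lit w by rewrite /lit vE ex_neg exw chiN.
    case E': (lit w).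
      by exists (Aux, v), (Aux, w); rewrite /= E E'.
    by exists (Aux, w), (Aux, v); rewrite /= E E'.
  - by case/negP: noRef; apply/existsP; exists w.
have onlyLC x : x \in M -> x.1 = Lit \/ x.1 = Cla.
  case: x => -[] v vM; [by left| |by right|].
    by case/negP: noAux; apply/existsP; exists v.
  by case/negP: noRef; apply/existsP; exists v.
have DM : (Lit, D) \in M.
  apply/negPn/negP=> DM; have [[r v] vM] := M2 _ DM.
  have [/= rE|/= rE] := onlyLC _ vM; rewrite rE /= in vM *.
    rewrite conflict_sym D_conflict andbT negbK => /eqP vD.
    by rewrite vD (negbTE DM) in vM.
  by rewrite D_hit.
have [/exists_inP[[r v] vM nv]|/exists_inPn allLit] :=
  boolP [exists x in M, ~~ ((x.1 == Lit) && lit x.2)].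
  exists (Lit, D), (r, v); split=> //; first by rewrite /= /lit D_ex.
  by have [/= rE|/= rE] := onlyLC _ vM; move: nv; rewrite rE.
have chiM v : (Lit, v) \in M -> ex v -> chi v.
  by move=> /allLit/negPn/=; rewrite /lit => + exv; rewrite exv.
(* Now [M] has only [Lit] vertices: being a clique it is free of conflicts, and the vertex that
   keeps [(Cla, c)] out of [M] hits [c]. *)
case: (noK [set v | (Lit, v) \in M]); last by move=> v; rewrite inE; apply: chiM.
split=> [v w|c].
  rewrite !inE => vM wM; have [->|nvw] := eqVneq v w; first by rewrite conflict_irr.
  by have /andP[] : kernel_adj (Lit, v) (Lit, w) by apply: adjM => // -[/eqP]; apply/negP.
have /M2[[r v] vM] : (Cla, c) \notin M.
  by apply/negP=> /allLit.
have [/= rE|/= rE] := onlyLC _ vM; rewrite rE /= in vM *.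
  by rewrite negbK => hcv; exists v; rewrite ?inE.
by move/allLit: vM.
Qed.

(** The edges at [Aux] and [Ref] lie in no triangle and so propagate colours. A kernel on which
    [chi] holds, together with [D], gives a clique of [Lit] vertices; any maximal clique containing
    it would be monochromatic. *)
Lemma kernel_colorable :
  clique_colorable kernel_adj ->
  exists2 chi : V -> bool, (forall v, ex v -> chi (neg v) = ~~ chi v) &
    forall K, kernel K -> ~ (forall v, v \in K -> ex v -> chi v).
Proof.
move=> [c Hc].
have bichr x y : kernel_adj x y -> (forall z, ~~ (kernel_adj x z && kernel_adj y z)) ->
    c x = ~~ c y.
  exact: (edge_bichromatic kernel_adj_sym kernel_adj_irr Hc).
(* All colours are measured against that of [(Aux, D)], as the two colours may be exchanged. *)
pose d := c (Aux, D).
have cRef v : c (Ref, v) = ~~ d.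
  apply: bichr => /=; first by rewrite D_ex.
  by case=> -[] w; rewrite /= ?D_ex ?andbF.
have cCla v : c (Cla, v) = d.
  rewrite -[d]negbK -(cRef v); apply: bichr => //.
  by case=> -[] w; rewrite /= ?andbF.
have cAux v : ~~ ex v -> c (Aux, v) = d.
  move=> exv; rewrite -[d]negbK -(cRef v); apply: bichr => //.
  by case=> -[] w; rewrite /= ?andbF // (negbTE exv).
have cLitAux v : c (Lit, v) = ~~ c (Aux, v).
  apply: bichr => /=; first by rewrite eqxx.
  case=> -[] w; rewrite /= ?andbF //.
    by rewrite andbAC; have [->|] := eqVneq v w; rewrite ?eqxx.
  apply/negP=> /and3P[/eqP<- /neg_neq/negbTE]; rewrite eq_sym.
  by move=> ->.
have cLit v : ~~ ex v -> c (Lit, v) = ~~ d by move=> exv; rewrite cLitAux cAux.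
pose chi v := c (Lit, v) == ~~ d.
exists chi => [v exv|K [K1 K2] Kchi].
  rewrite /chi !cLitAux.
  suff -> : c (Aux, v) = ~~ c (Aux, neg v) by case: (c _); case: (d).
  apply: bichr => /=; first by rewrite exv eqxx.
  case=> -[] w; rewrite /= ?exv ?andbF //.
    by apply/negP=> /andP[/eqP<- /eqP E]; have := neg_neq exv; rewrite E eqxx.
  apply/negP=> /and3P[/eqP-> _]; rewrite negK.
  by rewrite (negbTE (neg_neq exv)).
have cl : cliqueb kernel_adj [set (Lit, v) | v in D |: K].
  apply/cliqueP=> _ _ /imsetP[v vK ->] /imsetP[w wK ->] vw.
  have {vw} vw : v != w by apply: contraNneq vw => ->.
  rewrite /= vw; move: vK wK; rewrite !inE => /orP[/eqP->|vK] /orP[/eqP->|wK].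
  - by rewrite D_conflict.
  - by rewrite D_conflict.
  - by rewrite conflict_sym D_conflict.
  - exact: K1.
have [M maxM /subsetP KM] := clique_extend kernel_adj_sym kernel_adj_irr cl.
have KMv v : v \in K -> (Lit, v) \in M by move=> vK; apply/KM/imset_f; rewrite !inE vK orbT.
have DM : (Lit, D) \in M by apply/KM/imset_f; rewrite !inE eqxx.
(* The requirement indexed by [D] supplies a kernel element other than [D]; two distinct [Lit]
   vertices have no common [Aux] neighbour, which keeps [Aux] vertices out of [M]. *)
have [w0 w0K w0D] := K2 D.
have {}w0D : w0 != D by apply: contraTneq w0D => ->; rewrite D_hit.
have /max_cliqueP[M1 M2] := maxM.
have adjM x y : x \in M -> y \in M -> x <> y -> kernel_adj x y.
  by move=> xM yM /eqP; apply: M1.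
suff colM x : x \in M -> c x = ~~ d.
  have [x [y [/colM-> /colM->]]] := Hc M maxM.
  by case: (d).
case: x => -[] v vM.
(* Only [v] and [neg v] hit [v], so one of them is in [K]; it cannot be [neg v], which conflicts
   with [v]. *)
- have [exv|] := boolP (ex v); last exact: cLit.
  have [w wK /(neg_hit exv) vw] := K2 v.
  have chiw := Kchi w wK; case: vw => wE; subst w; first by apply/eqP/chiw.
  have /andP[_] : kernel_adj (Lit, v) (Lit, neg v).
    apply: adjM => //; first exact: KMv.
    by case=> E; move: (neg_neq exv); rewrite -E eqxx.
  by rewrite neg_conflict.
- have /eqP vE : kernel_adj (Lit, D) (Aux, v) by apply: adjM.
  have /eqP vE' : kernel_adj (Lit, w0) (Aux, v) by apply: adjM => //; apply: KMv.
  by rewrite vE' -vE eqxx in w0D.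
- have [w wK vw] := K2 v.
  have /= : kernel_adj (Lit, w) (Cla, v) by apply: adjM => //; apply: KMv.
  by rewrite vw.
- by have : kernel_adj (Lit, D) (Ref, v) by apply: adjM.
Qed.

End KernelGraph.

(** * Circuits for second-order sentences *)

Section Circuits.

Variables (s : vocabulary) (a1 a2 : seq nat) (d : nat).

Local Notation rels := ('I_(size a1) + 'I_(size a2))%type.
Local Notation voc := (ext_voc (ext_voc s a1) a2).
Local Notation D := d.+1.
Local Notation env n := (D.-tuple 'I_n.+2).

Definition so_sym (R : rels) : rsym voc :=
  match R with inl i => inl (inr i) | inr i => inr i end.

(* A gate is a pair of an instruction number and an assignment [t : env n]. *)
Inductive instr : Type :=
| ITest of formula num_voc D
| IInp (r : rsym s) of (arity r).-tuple 'I_D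
| IVar (R : rels) of (arity (so_sym R)).-tuple 'I_D
| ICst of csym s & 'I_D
| INor of nat & nat
| INex of 'I_D & nat.

Definition proj_env n k (t : env n) (pos : k.-tuple 'I_D) : k.-tuple 'I_n.+2 :=
  [tuple of map (tnth t) pos].

Definition agree_off n (p : 'I_D) (t u : env n) : bool :=
  [forall q, (q != p) ==> (tnth t q == tnth u q)].

Definition gate_value n (A : structure voc n.+2) (Z : nat -> env n -> bool)
    (I : instr) (t : env n) : bool :=
  match I with
  | ITest a => num_sat a t
  | IInp r pos => proj_env t pos \in @srel voc _ A (inl (inl r))
  | IVar R pos => proj_env t pos \in srel A (so_sym R)
  | ICst c p => @scst voc _ A c == tnth t p
  | INor i j => ~~ (Z i t || Z j t)
  | INex p i => ~~ [exists u, agree_off p t u && Z i u]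
  end.

Definition default_instr : instr := INor 0 0.

Definition computes (L : seq instr) n (A : structure voc n.+2)
    (Z : nat -> env n -> bool) : Prop :=
  forall i, i < size L -> forall t, Z i t = gate_value A Z (nth default_instr L i) t.

Definition instr_lt (I : instr) (i : nat) : bool :=
  match I with
  | INor j k => (j < i) && (k < i)
  | INex _ j => j < i
  | _ => true
  end.

Definition acyclic (L : seq instr) : Prop :=
  forall i, i < size L -> instr_lt (nth default_instr L i) i.

Lemma gate_value_local n (A : structure voc n.+2) (Z Z' : nat -> env n -> bool) I i t :
  instr_lt I i -> (forall j t, j < i -> Z j t = Z' j t) ->
  gate_value A Z I t = gate_value A Z' I t.
Proof.
case: I => //= [j k /andP[ji ki] H|p j ji H]; first by rewrite !H.
by congr (~~ _); apply: eq_existsb => u; rewrite H.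
Qed.

Lemma acyclic_rcons L I : acyclic L -> instr_lt I (size L) -> acyclic (rcons L I).
Proof.
move=> wL wI i; rewrite size_rcons ltnS nth_rcons.
by case: ltngtP => // [/wL|->].
Qed.

(** Values are defined along the list: the last instruction reads earlier values only, and no
    earlier instruction reads the new one. *)
Lemma acyclic_computes L n (A : structure voc n.+2) :
  acyclic L -> exists Z, computes L A Z.
Proof.
elim/last_ind: L => [|L I IH] wL; first by exists (fun _ _ => false).
have [|Z HZ] := IH.
  move=> i iL; have := wL i; rewrite size_rcons nth_rcons iL; apply; exact: ltnW.
have eqn i (iL : i < size L) : nth default_instr (rcons L I) i = nth default_instr L i.
  by rewrite nth_rcons iL.
exists (fun i t => if i == size L then gate_value A Z I t else Z i t) => i iL t.
have := wL _ iL; move: iL; rewrite size_rcons ltnS leq_eqVlt => /orP[/eqP->|iL] wi.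
  rewrite eqxx nth_rcons ltnn eqxx in wi *; apply: gate_value_local wi _ => j u ji.
  by rewrite ltn_eqF.
rewrite ltn_eqF // HZ // -eqn //; apply: gate_value_local wi _ => j u ji.
by rewrite ltn_eqF // (ltn_trans ji).
Qed.

Lemma computes_cat L L' n (A : structure voc n.+2) Z :
  computes (L ++ L') A Z -> computes L A Z.
Proof.
move=> HZ i iL t; rewrite HZ ?size_cat ?ltn_addr // nth_cat iL //.
Qed.

Local Notation env_pred := (forall n, structure voc n.+2 -> env n -> bool).

(* Quantifying over the circuit [L] to be extended lets two subformulas be
   compiled one after the other without renumbering instructions. *)
Definition computable (dom P : env_pred) : Prop :=
  forall L, acyclic L -> exists L', acyclic (L ++ L') /\
    exists2 i, i < size (L ++ L') & forall n (A : structure voc n.+2) Z,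
      computes (L ++ L') A Z -> forall t, dom n A t -> Z i t = P n A t.

Lemma eq_computable (dom P Q : env_pred) :
  (forall n A t, dom n A t -> P n A t = Q n A t) ->
  computable dom P -> computable dom Q.
Proof.
move=> PQ HP L /HP[L' [wL [i iL Hi]]]; exists L'; split=> //; exists i => // n A Z HZ t dt.
by rewrite (Hi _ A) // PQ.
Qed.

Lemma computable_instr (dom P : env_pred) I :
  (forall n A Z t, dom n A t -> gate_value A Z I t = P n A t) ->
  (forall i, instr_lt I i) -> computable dom P.
Proof.
move=> HP HI L wL; exists [:: I]; rewrite cats1; split; first exact: acyclic_rcons.
exists (size L); rewrite ?size_rcons // => n A Z HZ t dt.
by rewrite HZ ?size_rcons // nth_rcons ltnn eqxx HP.
Qed.

(* [P] is only needed where [Q] does not already decide the result. *)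
Lemma computable_nor_guard (dom dom' P Q : env_pred) :
  computable dom' P -> computable dom Q ->
  (forall n A t, dom n A t -> ~~ Q n A t -> dom' n A t) ->
  computable dom (fun n A t => ~~ (P n A t || Q n A t)).
Proof.
move=> HP HQ Hdom L /HP[L1 [/HQ[L2 [w2 [j jL Hj]]] [i iL Hi]]].
exists (L1 ++ rcons L2 (INor i j)); rewrite !catA -rcons_cat.
have iL' : i < size ((L ++ L1) ++ L2) by rewrite size_cat ltn_addr.
split; first by apply: acyclic_rcons => //=; rewrite iL'.
exists (size ((L ++ L1) ++ L2)); rewrite ?size_rcons // => n A Z HZ t dt.
rewrite HZ ?size_rcons // nth_rcons ltnn eqxx /=.
move: HZ; rewrite -cats1 => /computes_cat HZ.
rewrite (Hj _ A) //; have [_|nQ] := boolP (Q n A t); first by rewrite !orbT.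
by rewrite (Hi _ A) //; [apply: computes_cat HZ | apply: Hdom].
Qed.

Lemma computable_nor (dom P Q : env_pred) :
  computable dom P -> computable dom Q ->
  computable dom (fun n A t => ~~ (P n A t || Q n A t)).
Proof. by move=> HP HQ; apply: computable_nor_guard HP HQ _. Qed.

Lemma computable_neg (dom P : env_pred) :
  computable dom P -> computable dom (fun n A t => ~~ P n A t).
Proof.
move=> HP; apply: eq_computable (computable_nor HP HP) => n A t _.
by rewrite orbb.
Qed.

Lemma computable_or (dom P Q : env_pred) :
  computable dom P -> computable dom Q ->
  computable dom (fun n A t => P n A t || Q n A t).
Proof.
move=> HP HQ; apply: eq_computable (computable_neg (computable_nor HP HQ)) => n A t _.
by rewrite negbK.
Qed.

Lemma computable_and (dom P Q : env_pred) :
  computable dom P -> computable dom Q ->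
  computable dom (fun n A t => P n A t && Q n A t).
Proof.
move=> HP HQ.
apply: eq_computable (computable_nor (computable_neg HP) (computable_neg HQ)) => n A t _.
by rewrite negb_or !negbK.
Qed.

Definition upd n (t : env n) (p : 'I_D) (x : 'I_n.+2) : env n :=
  [tuple if q == p then x else tnth t q | q < D].

(** [INex] yields the negated quantifier, and a further negation restores it. The gate for [P] is
    read at every update of [t] at [p], whence the stability of [dom]. *)
Lemma computable_ex (dom P : env_pred) p :
  (forall n A t x, dom n A t -> dom n A (upd t p x)) ->
  computable dom P ->
  computable dom (fun n A t => [exists x, P n A (upd t p x)]).
Proof.
move=> domS HP.
suff HE : computable dom (fun n A t => ~~ [exists x, P n A (upd t p x)]).
  apply: eq_computable (computable_neg HE) => n A t _; exact: negbK.
move=> L /HP[L1 [w1 [i iL Hi]]].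
exists (rcons L1 (INex p i)); rewrite -rcons_cat.
split; first exact: acyclic_rcons.
exists (size (L ++ L1)); rewrite ?size_rcons // => n A Z HZ t dt.
rewrite HZ ?size_rcons // nth_rcons ltnn eqxx /=.
move: HZ; rewrite -cats1 => /computes_cat HZ.
congr (~~ _); apply/existsP/existsP => [[u /andP[/forallP tu Zu]]|[x Px]].
  have uE : u = upd t p (tnth u p).
    apply: eq_from_tnth => q; rewrite tnth_mktuple.
    by have [->//|qp] := eqVneq; rewrite (eqP (implyP (tu q) qp)).
  exists (tnth u p); rewrite -uE -(Hi _ _ _ HZ) // uE; exact: domS.
exists (upd t p x); rewrite (Hi _ _ _ HZ) ?Px ?andbT; last exact: domS.
by apply/forallP=> q; apply/implyP=> /negbTE qp; rewrite tnth_mktuple qp.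
Qed.

Lemma computable_false (dom : env_pred) : computable dom (fun _ _ _ => false).
Proof.
apply: (@computable_instr _ _ (ITest (FNot (FEq TZero TZero)))) => // n A Z t _.
Qed.

Lemma computable_has (dom : env_pred) (T : Type) (r : seq T) (P : T -> env_pred) :
  (forall x, computable dom (P x)) ->
  computable dom (fun n A t => has (fun x => P x n A t) r).
Proof.
move=> HP; elim: r => [|x r IH] /=; first exact: computable_false.
exact: (computable_or (HP x) IH).
Qed.

(* The first positions of an assignment hold 0, 1, max and the constants, the
   following ones the values of the variables, outermost quantifier first. *)
Local Notation base := (3 + #|csym s|).

Definition cst_pos (c : csym s) : 'I_D := inord (3 + enum_rank c).

(** The de Bruijn index [i] under [k] binders becomes the level [k - i.+1], which does not change
    when further quantifiers are entered. *)
Definition term_pos k (t : term voc k) : 'I_D :=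
  inord match t with
  | TVar i => base + (k - i.+1)
  | TCst c => 3 + enum_rank (c : csym s)
  | TZero => 0
  | TOne => 1
  | TMax => 2
  end.

Definition default_terms : seq (term num_voc D) :=
  [:: TZero; TOne; TMax].

(** Written as a negated disjunction of failures, the shape handled by [computable_nor] and
    [computable_has]. *)
Definition well_set n (A : structure voc n.+2) (t : env n) : bool :=
  ~~ (has (fun i => ~~ num_sat (FEq (TVar (inord i)) (nth TZero default_terms i)) t) (iota 0 3)
  || has (fun c => @scst voc _ A c != tnth t (cst_pos c)) (enum (csym s))).

Definition var_env n k (t : env n) : k.-tuple 'I_n.+2 :=
  [tuple tnth t (inord (base + (k - (i : nat).+1))) | i < k].

Lemma computable_well_set : computable (fun _ _ _ => true) well_set.
Proof.
apply: computable_nor; apply: computable_has => x; apply: computable_neg.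
  by apply: (@computable_instr _ _ (ITest _)).
by apply: (@computable_instr _ _ (ICst _ _)).
Qed.

Lemma well_setP n (A : structure voc n.+2) t : well_set A t <->
  [/\ tnth t (inord 0) = ord0, tnth t (inord 1) = inord 1, tnth t (inord 2) = ord_max
    & forall c : csym s, @scst voc _ A c = tnth t (cst_pos c)].
Proof.
rewrite /well_set negb_or; split=> [/andP[/hasPn H1 /hasPn H2]|[H0 H1 H2 H3]].
  split.
  - by have /negPn/eqP := H1 0 isT.
  - by have /negPn/eqP := H1 1 isT.
  - by have /negPn/eqP := H1 2 isT.
  - by move=> c; have /negPn/eqP := H2 c (mem_enum _ _).
apply/andP; split; last by apply/hasPn=> c _; rewrite negbK H3.
by rewrite /= /num_sat /= H0 H1 H2 !eqxx.
Qed.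

Lemma teval_pos n (A : structure voc n.+2) t k (u : term voc k) :
  well_set A t -> teval A (var_env k t) u = tnth t (term_pos u).
Proof.
move/well_setP=> [H0 H1 H2 H3]; case: u => [i|c| | |] //=; first by rewrite tnth_mktuple.
Qed.

Lemma map_teval_pos n (A : structure voc n.+2) t k a (us : a.-tuple (term voc k)) :
  well_set A t ->
  [tuple of map (teval A (var_env k t)) us] = proj_env t [tuple of map (@term_pos k) us].
Proof.
move=> wt; apply: val_inj => /=; rewrite -map_comp.
by apply: eq_map => u; apply: teval_pos.
Qed.

Fixpoint quant_depth k (phi : formula voc k) : nat :=
  match phi with
  | FNot _ f => quant_depth f
  | FAnd _ f g => maxn (quant_depth f) (quant_depth g)
  | FOr _ f g => maxn (quant_depth f) (quant_depth g)
  | FExists _ f => (quant_depth f).+1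
  | FForall _ f => (quant_depth f).+1
  | _ => 0
  end.

Lemma base_pos_neq k p : base + k <= d -> p < base -> (inord p == inord (base + k) :> 'I_D) = false.
Proof.
move=> kd pb; apply/eqP=> /(congr1 val); rewrite /= !inordK ?ltnS //.
  by move=> E; rewrite E ltnNge leq_addr in pb.
by apply: leq_trans (ltnW pb) _; apply: leq_trans kd; apply: leq_addr.
Qed.

Lemma well_set_upd n (A : structure voc n.+2) t k x :
  base + k <= d -> well_set A t -> well_set A (upd t (inord (base + k)) x).
Proof.
move=> kd /well_setP[H0 H1 H2 H3]; apply/well_setP.
have E p : p < base -> tnth (upd t (inord (base + k)) x) (inord p) = tnth t (inord p).
  by move=> pb; rewrite tnth_mktuple base_pos_neq.
split; [by rewrite E | by rewrite E | by rewrite E |].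
by move=> c; rewrite H3 E // ltn_add2l.
Qed.

(** Position [base + k] is the level of the newly bound variable, while the older variables sit at
    lower levels and keep their values. *)
Lemma var_env_upd n k (t : env n) x :
  base + k <= d -> var_env k.+1 (upd t (inord (base + k)) x) = [tuple of x :: var_env k t].
Proof.
move=> kd; apply: eq_from_tnth => i; rewrite tnth_mktuple.
case: (unliftP ord0 i) => [j ->|->]; last by rewrite subn1 tnth_mktuple eqxx tnth0.
rewrite tnthS !tnth_mktuple lift0 subSS.
suff -> : (inord (base + (k - j.+1)) == inord (base + k) :> 'I_D) = false by [].
apply/eqP=> /(congr1 val); rewrite /= !inordK ?ltnS //.
  by move/addnI => E; move: (ltn_ord j); rewrite -subn_gt0 -[X in _ - X]subn0; lia.
by apply: leq_trans kd; rewrite leq_add2l leq_subr.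
Qed.

(** Each atom is one instruction reading the positions of its terms. A quantifier under [k] binders
    ranges over position [base + k], and the bound reserves a position for every nested
    quantifier. *)
Lemma computable_sat k (phi : formula voc k) :
  base + k + quant_depth phi <= d.+1 ->
  computable well_set (fun n A t => sat A phi (var_env k t)).
Proof.
elim: phi => {k} /=.
- move=> k [[r|i]|i] us _.
  + apply: (@computable_instr _ _ (@IInp r [tuple of map (@term_pos k) us])) => //=
    n A Z t wt.
    by rewrite map_teval_pos.
  + apply: (@computable_instr _ _ (@IVar (inl i) [tuple of map (@term_pos k) us])) => //=
    n A Z t wt.
    by rewrite map_teval_pos.
  + apply: (@computable_instr _ _ (@IVar (inr i) [tuple of map (@term_pos k) us])) => //=
    n A Z t wt.
    by rewrite map_teval_pos.
- move=> k u v _.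
  apply: (@computable_instr _ _ (ITest (FEq (TVar (term_pos u)) (TVar (term_pos v))))) => //=
    n A Z t wt.
  by rewrite !teval_pos.
- move=> k u v _.
  apply: (@computable_instr _ _ (ITest (FLe (TVar (term_pos u)) (TVar (term_pos v))))) => //=
    n A Z t wt.
  by rewrite !teval_pos.
- move=> k u v _.
  apply: (@computable_instr _ _ (ITest (FSuc (TVar (term_pos u)) (TVar (term_pos v))))) => //=
    n A Z t wt.
  by rewrite !teval_pos.
- move=> k u v _.
  apply: (@computable_instr _ _ (ITest (FBit (TVar (term_pos u)) (TVar (term_pos v))))) => //=
    n A Z t wt.
  by rewrite !teval_pos.
- move=> k u v w _.
  apply: (@computable_instr _ _ (ITest (FPlus (TVar (term_pos u)) (TVar (term_pos v))
    (TVar (term_pos w))))) => //=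
    n A Z t wt.
  by rewrite !teval_pos.
- move=> k u v w _.
  apply: (@computable_instr _ _ (ITest (FTimes (TVar (term_pos u)) (TVar (term_pos v))
    (TVar (term_pos w))))) => //=
    n A Z t wt.
  by rewrite !teval_pos.
- by move=> k f IH kd; apply: computable_neg; apply: IH.
- move=> k f IHf g IHg kd; apply: computable_and; [apply: IHf|apply: IHg]; apply: leq_trans kd.
    by rewrite leq_add2l leq_maxl.
  by rewrite leq_add2l leq_maxr.
- move=> k f IHf g IHg kd; apply: computable_or; [apply: IHf|apply: IHg]; apply: leq_trans kd.
    by rewrite leq_add2l leq_maxl.
  by rewrite leq_add2l leq_maxr.
- move=> k f IH kd.
  have kd1 : base + k <= d by move: kd; rewrite addnS ltnS; apply: leq_trans; apply: leq_addr.
  have := computable_ex (fun n A t x => @well_set_upd n A t k x kd1) (IH _).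
  move=> H; apply: eq_computable (H _) => [n A t _|]; last by rewrite [base + _]addnS addSn -addnS.
  by apply: eq_existsb => x; rewrite var_env_upd.
- move=> k f IH kd.
  have kd1 : base + k <= d by move: kd; rewrite addnS ltnS; apply: leq_trans; apply: leq_addr.
  have := computable_ex (fun n A t x => @well_set_upd n A t k x kd1) (computable_neg (IH _)).
  move=> H; apply: eq_computable (computable_neg (H _)) => [n A t _|];
    last by rewrite [base + _]addnS addSn -addnS.
  rewrite negb_exists; apply: eq_forallb => x.
  by rewrite var_env_upd ?negbK.
Qed.

(** The compiled gates are correct only at well-set assignments, so the output is guarded by
    [well_set]; as such assignments exist, it is true somewhere exactly when [phi] fails. *)
Lemma sentence_circuit (phi : formula voc 0) :
  base + quant_depth phi <= d.+1 ->
  exists L, acyclic L /\ exists2 i, i < size L & forall n (A : structure voc n.+2) Z,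
    computes L A Z -> forall t, Z i t = well_set A t && ~~ sat A phi [tuple].
Proof.
rewrite -[base]addn0 => kd.
have guard n (A : structure voc n.+2) t : true -> ~~ ~~ well_set A t -> well_set A t.
  by rewrite negbK.
have acyclic_nil : acyclic [::] by [].
have [L [wL [i iL Hi]]] := computable_nor_guard
  (computable_sat kd) (computable_neg computable_well_set) guard acyclic_nil.
exists L; split=> //; exists i => // n A Z HZ t.
rewrite (Hi _ _ _ HZ) // negb_or negbK andbC.
by rewrite [var_env _ _]tuple0.
Qed.
End Circuits.

(** * Kernels of the gate digraph *)

(** A tag paired with an assignment is a gate. [TLit R b] asserts that the bit of [R] at the
    assignment equals [b]; [TTrue] will have no children, hence is always true. *)
Inductive gate_tag (X : finType) (N : nat) : Type :=
| TTop
| TTrue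
| TLit of X & bool
| TGate of 'I_N.
Arguments TTop {X N}.
Arguments TTrue {X N}.
Arguments TLit {X N} _ _.
Arguments TGate {X N} _.

Definition sum_of_tag X N (x : gate_tag X N) : bool + (X * bool) + 'I_N :=
  match x with
  | TTop => inl (inl true) | TTrue => inl (inl false)
  | TLit R b => inl (inr (R, b)) | TGate i => inr i
  end.

Definition tag_of_sum (X : finType) N (x : bool + (X * bool) + 'I_N) : gate_tag X N :=
  match x with
  | inl (inl true) => TTop | inl (inl false) => TTrue
  | inl (inr (R, b)) => TLit R b | inr i => TGate i
  end.

Lemma sum_of_tagK X N : cancel (@sum_of_tag X N) (@tag_of_sum X N).
Proof. by case. Qed.

HB.instance Definition _ X N := Finite.copy (gate_tag X N) (can_type (@sum_of_tagK X N)).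

Section Gates.

Variables (s : vocabulary) (a1 a2 : seq nat) (d : nat).

Local Notation rels := ('I_(size a1) + 'I_(size a2))%type.
Local Notation voc := (ext_voc (ext_voc s a1) a2).
Local Notation D := d.+1.
Local Notation env n := (D.-tuple 'I_n.+2).

Lemma well_set_exists n (A : structure voc n.+2) :
  3 + #|csym s| <= D -> exists t : env n, well_set A t.
Proof.
move=> bD.
pose l := [:: ord0; inord 1; ord_max] ++ [seq @scst voc _ A c | c <- enum (csym s)].
have E (p : nat) : p < 3 + #|csym s| -> tnth [tuple nth ord0 l q | q < D] (inord p) = nth ord0 l p.
  by move=> pb; rewrite tnth_mktuple inordK //; apply: leq_trans bD.
exists [tuple nth ord0 l q | q < D]; apply/well_setP; split; rewrite ?E //.
move=> c; rewrite E ?ltn_add2l // nth_cat /=.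
by rewrite addKn (nth_map c) ?nth_enum_rank -?cardE.
Qed.

(** Tuples of every arity become full-length assignments, so that relation bits are gates like the
    others. *)
Definition pad n k (u : k.-tuple 'I_n.+2) : env n := [tuple nth ord0 u j | j < D].

Definition cut n k (t : env n) : k.-tuple 'I_n.+2 := [tuple nth ord0 t j | j < k].

Lemma padK n k : k <= D -> cancel (@pad n k) (@cut n k).
Proof.
move=> kD u; apply: eq_from_tnth => i; rewrite tnth_mktuple.
have iD : i < D := leq_trans (ltn_ord i) kD.
by rewrite -[i : nat]/(Ordinal iD : nat) -tnth_nth tnth_mktuple /= -tnth_nth.
Qed.

Variables (L : seq (instr s a1 a2 d)) (o : 'I_(size L)).
Hypothesis acyclicL : acyclic L.
Hypothesis arity_le : forall R : rels, arity (so_sym s R) <= D.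

Local Notation gtag := (gate_tag rels (size L)).
Local Notation gate n := (gtag * env n)%type.

(** An atom gate has the child [TTrue] exactly when the atom fails, and an [IVar] gate has the
    negative literal of its bit as child, so that in each case the negated disjunction of the
    children is the intended value. *)
Definition instr_child n (A : structure s n.+2) (I : instr s a1 a2 d) (t : env n)
    (x : gtag) (u : env n) : bool :=
  match I, x with
  | ITest a, TTrue => ~~ num_sat a t
  | IInp r pos, TTrue => proj_env t pos \notin srel A r
  | ICst c p, TTrue => scst A c != tnth t p
  | IVar R pos, TLit R' b => [&& R' == R, ~~ b & u == pad (proj_env t pos)]
  | INor i j, TGate q => ((q == i :> nat) || (q == j :> nat)) && (u == t)
  | INex p i, TGate q => (q == i :> nat) && agree_off p t u
  | _, _ => false
  end.

Definition nth_instr (i : nat) : instr s a1 a2 d := nth (default_instr s a1 a2 d) L i.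

Definition child n (A : structure s n.+2) (c v : gate n) : bool :=
  match c.1 with
  | TLit R b => v == (TLit R (~~ b), c.2)
  | TGate i => instr_child A (nth_instr i) c.2 v.1 v.2
  | _ => false
  end.

Definition conflict n (A : structure s n.+2) (v w : gate n) : bool :=
  child A v w || child A w v.

(* [TTop] conflicts with no gate and hits no clause, so that its [Lit] vertex lies
   in every maximal clique without [Aux] and [Ref] vertices; the clause it leaves
   free is used to require the output. *)
Definition hit n (A : structure s n.+2) (c v : gate n) : bool :=
  if c.1 == TTop then v.1 == TGate o else (v == c) || child A c v.

(** The colouring fixes only the bits of the existential relations; those of the universal ones are
    left to the clique. *)
Definition guessed n (v : gate n) : bool :=
  if v.1 is TLit (inl _) _ then true else false.

Definition opposite n (v : gate n) : gate n :=
  if v.1 is TLit R b then (TLit R (~~ b), v.2) else v.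

Section Model.

Variables (n : nat) (A : structure s n.+2).

Lemma child_Top c t : child A c (TTop, t) = false.
Proof.
case: c => [[| |R b|i] u] //=; rewrite /child /=.
by case: (nth_instr i).
Qed.

Lemma child_irr c : child A c c = false.
Proof.
case: c => [[| |R b|i] u] //=; rewrite /child /=.
  by apply/eqP=> -[]; case: b.
have := acyclicL (ltn_ord i); rewrite -/(nth_instr i).
case: (nth_instr i) => //= [j k /andP[ji ki]|p j ji].
  by rewrite !gtn_eqF.
by rewrite gtn_eqF.
Qed.

Lemma conflict_sym : symmetric (conflict A).
Proof. by move=> v w; rewrite /conflict orbC. Qed.

Lemma conflict_irr : irreflexive (conflict A).
Proof. by move=> v; rewrite /conflict !child_irr. Qed.

Lemma oppositeK : involutive (@opposite n).
Proof. by case=> [[| |R b|i] u] //=; rewrite /opposite /= negbK. Qed.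

Lemma guessed_opposite v : guessed (@opposite n v) = guessed v.
Proof. by case: v => [[| |R b|i] u]. Qed.

Lemma opposite_neq v : guessed v -> @opposite n v != v.
Proof. by case: v => [[| |R b|i] u] //= _; apply/eqP=> -[]; case: b. Qed.

Lemma conflict_Top t v : conflict A (TTop, t) v = false.
Proof. by rewrite /conflict child_Top. Qed.

Lemma hit_Top c t : hit A c (TTop, t) = false.
Proof.
rewrite /hit; have [//|nc] := eqVneq; rewrite child_Top orbF.
by apply: contraNF nc => /eqP<-.
Qed.

Lemma conflict_opposite v : guessed v -> conflict A v (opposite v).
Proof. by case: v => [[| |R b|i] u] //= _; rewrite /conflict /child /= eqxx. Qed.

Lemma hit_opposite v : guessed v -> forall w, hit A v w -> w = v \/ w = opposite v.
Proof.
by case: v => [[| |R b|i] u] //= _ w /orP[]/eqP->; [left|right].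
Qed.

(* [TTop] is exempt: it is not a gate of the circuit. *)
Definition consistent (K : pred (gate n)) : Prop :=
  forall c, c.1 != TTop -> K c = ~~ [exists v, child A c v && K v].

(** Independence forbids a true child to a true gate, and the hitting condition gives one to every
    false gate. The requirement indexed by [TTop] makes an output gate true. *)
Lemma kernel_consistent (K : {set gate n}) :
  kernel (conflict A) (hit A) K ->
  consistent (mem K) /\ exists t, (TGate o, t) \in K.
Proof.
move=> [K1 K2]; split=> [c cT|].
  rewrite /=; have [cK|ncK] := boolP (c \in K); apply/esym.
    apply/existsP=> -[v /andP[cv vK]].
    by have := K1 c v cK vK; rewrite /conflict cv.
  apply/negbF; apply/existsP; have [v vK] := K2 c; rewrite /hit (negbTE cT).
  case/orP=> [/eqP vc|cv]; first by rewrite -vc vK in ncK.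
  by exists v; rewrite cv.
have [[x t] vK] := K2 (TTop, [tuple ord0 | i < D]).
by rewrite /hit /= => /eqP xo; exists t; rewrite -xo.
Qed.

(** Since [K] avoids [TTop], the consistency equation applies to all its gates and gives
    independence. *)
Lemma consistent_kernel (K : pred (gate n)) t :
  consistent K -> (forall u, K (TTop, u) = false) -> K (TGate o, t) ->
  kernel (conflict A) (hit A) [set v | K v].
Proof.
move=> cK KT Ko.
have nochild v w : K v -> K w -> child A v w = false.
  move=> Kv Kw; have vT : v.1 != TTop.
    by apply: contraTneq Kv; case: v => x u /= ->; rewrite KT.
  apply: contraTF Kv => vw; rewrite cK // negbK; apply/existsP.
  by exists w; rewrite vw.
split=> [v w|c]; first by rewrite !inE /conflict => Kv Kw; rewrite !nochild.
rewrite /hit; have [cT|cT] := boolP (c.1 == TTop).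
  by exists (TGate o, t); rewrite ?inE //=.
have [Kc|] := boolP (K c); first by exists c; rewrite ?inE // eqxx.
by rewrite cK // negbK => /existsP[v /andP[cv Kv]]; exists v; rewrite ?inE ?cv ?orbT.
Qed.

Definition compatible (A' : structure voc n.+2) (K : pred (gate n)) : Prop :=
  [/\ forall r : rsym s, @srel voc _ A' (inl (inl r)) = srel A r,
      forall c : csym s, @scst voc _ A' c = scst A c &
      forall (R : rels) (u : (arity (so_sym s R)).-tuple 'I_n.+2),
        (u \in srel A' (so_sym s R)) = K (TLit R true, pad u)].

(** Instruction by instruction, the digraph imitates the circuit: this is what turns consistent
    valuations into computations and back. *)
Lemma instr_childE (A' : structure voc n.+2) (K : pred (gate n)) (Z : nat -> env n -> bool) i t :
  compatible A' K -> (forall u, K (TTrue, u)) ->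
  (forall R u, K (TLit R false, u) = ~~ K (TLit R true, u)) ->
  (forall (q : 'I_(size L)) u, K (TGate q, u) = Z q u) -> i < size L ->
  gate_value A' Z (nth_instr i) t = ~~ [exists v, instr_child A (nth_instr i) t v.1 v.2 && K v].
Proof.
move=> [HR Hc HX] KT KL KG iL; have := acyclicL iL; rewrite -/(nth_instr i).
(* Covers the gates whose only possible child is [TTrue], present exactly when the condition [b]
   fails. *)
have test b (f : gate n -> bool) : (forall u, f (TTrue, u) = ~~ b) ->
    (forall v, v.1 != TTrue -> f v = false) -> b = ~~ [exists v, f v && K v].
  move=> f1 f2; apply/esym; case: b f1 => f1.
    apply/existsP=> -[[x u] /andP[]]; have [->|nx] := eqVneq x TTrue; first by rewrite f1.
    by rewrite f2.
  by apply/negbF; apply/existsP; exists (TTrue, t); rewrite f1 KT.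
case: (nth_instr i) => [a|r pos|R pos|c p|j k|p j] /=.
- by move=> _; apply: test => // -[[]].
- by move=> _; rewrite HR; apply: test => // -[[]].
- move=> _; rewrite HX -[LHS]negbK -KL; congr (~~ _); apply/esym; apply/existsP/idP.
    by case=> -[[| |R' b|q] u] //= /andP[/and3P[/eqP-> /negbTE-> /eqP->]].
  by move=> KP; exists (TLit R false, pad (proj_env t pos)); rewrite /= !eqxx.
- by move=> _; rewrite Hc; apply: test => // -[[]].
- case/andP=> ji ki; congr (~~ _); apply/esym; apply/existsP/orP.
    by case=> -[[| |R' b|q] u] //= /andP[/andP[/orP[]/eqP<- /eqP->]]; rewrite KG; [left|right].
  case=> HZ; [exists (TGate (Ordinal (ltn_trans ji iL)), t)
             |exists (TGate (Ordinal (ltn_trans ki iL)), t)];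
  by rewrite KG /= !eqxx ?orbT.
- move=> ji; congr (~~ _); apply/esym; apply/existsP/existsP.
    case=> -[[| |R' b|q] u] //= /andP[/andP[/eqP<- tu]]; rewrite KG => Zu.
    by exists u; rewrite tu.
  case=> u /andP[tu Zu]; exists (TGate (Ordinal (ltn_trans ji iL)), u).
  by rewrite KG /= eqxx tu.
Qed.

Lemma consistent_True (K : pred (gate n)) u : consistent K -> K (TTrue, u).
Proof. by move=> cK; rewrite cK //; apply/existsP=> -[v]. Qed.

Lemma consistent_Lit (K : pred (gate n)) R u b :
  consistent K -> K (TLit R b, u) = ~~ K (TLit R (~~ b), u).
Proof.
move=> cK; rewrite cK //; congr (~~ _); apply/existsP/idP.
  by case=> v /andP[/eqP-> //].
by move=> KP; exists (TLit R (~~ b), u); rewrite /child /= eqxx.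
Qed.

Variables (phi : formula voc 0).
Hypothesis base_le : 3 + #|csym s| <= D.
Hypothesis outputE : forall (A' : structure voc n.+2) Z,
    computes L A' Z -> forall t, Z o t = well_set A' t && ~~ sat A' phi [tuple].

(** The gates in a kernel form a computation of the circuit on [A'] in which the output is true
    somewhere. *)
Lemma kernel_sat (K : {set gate n}) (A' : structure voc n.+2) :
  kernel (conflict A) (hit A) K -> compatible A' (mem K) -> ~~ sat A' phi [tuple].
Proof.
move=> /kernel_consistent[cK [t oK]] comp.
pose Z i u := if insub i is Some q then (TGate q, u) \in K else false.
have HZ : computes L A' Z.
  move=> i iL u; rewrite {1}/Z insubT -/(nth_instr i).
  rewrite (@instr_childE A' (mem K)) //.
  - exact: cK.
  - by move=> {}u; apply: consistent_True.
  - by move=> R {}u; apply: (consistent_Lit R u false cK).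
  - by move=> q {}u; rewrite /Z valK.
have := outputE HZ t; rewrite /Z valK oK => /esym/andP[] //.
Qed.

(** The bits [W] are completed by evaluating the circuit; a well-set assignment makes the output
    true. Compatibility is assumed for every valuation with the bits [W] because the kernel is built
    only inside the proof. *)
Lemma sat_kernel (W : rels -> env n -> bool) (A' : structure voc n.+2) :
  (forall K : pred (gate n), (forall R u, K (TLit R true, u) = W R u) -> compatible A' K) ->
  ~~ sat A' phi [tuple] ->
  exists2 K : {set gate n}, kernel (conflict A) (hit A) K &
    forall R b u, ((TLit R b, u) \in K) = (W R u == b).
Proof.
move=> comp nsat.
have [Z HZ] := acyclic_computes A' acyclicL.
pose K (v : gate n) := match v.1 with
  | TTop => false | TTrue => true
  | TLit R b => W R v.2 == b | TGate q => Z q v.2 end.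
exists [set v | K v]; last by move=> R b u; rewrite inE.
have [t wt] := well_set_exists A' base_le.
have compK : compatible A' K by apply: comp => R u; rewrite /K /=; case: (W R u).
apply: (@consistent_kernel K t) => //; last by rewrite /K /= (outputE HZ) wt.
case=> -[| |R b|i] u //= _.
- by apply/esym; apply/existsP=> -[].
- rewrite {1}/K /=; apply/idP/existsPn=> [/eqP<- v|/(_ (TLit R (~~ b), u))].
    by apply/negP=> /andP[/eqP->]; rewrite /K /=; case: (W R u).
  by rewrite /child /= eqxx /K /=; case: (W R u); case: b.
- rewrite {1}/K /= HZ // -/(nth_instr i) (@instr_childE A' K) //.
  by move=> R {}u; rewrite /K /=; case: (W R u).
Qed.

(** [chi] and the existential relations [X1] are read off from one another. A universal choice
    refuting the sentence then corresponds to a kernel on which [chi] holds. *)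
Lemma colorable_sigma2 :
  clique_colorable (kernel_adj (conflict A) (hit A) (@guessed n) (@opposite n)) <->
  sigma2_models phi A.
Proof.
have T0 : env n := [tuple ord0 | i < D].
split=> [/(kernel_colorable conflict_sym oppositeK guessed_opposite opposite_neq
   (conflict_Top T0) (hit_Top ^~ T0) erefl conflict_opposite hit_opposite)[chi chiN noK]|].
  exists (fun i => [set u | chi (TLit (inl i) true, pad u)]) => X2.
  apply/negPn/negP=> nsat.
  pose W (R : rels) u := match R with
    | inl i => chi (TLit (inl i) true, u) | inr i => cut _ u \in X2 i end.
  have [|K Kker KW] := sat_kernel (W := W) _ nsat.
    move=> K KW; split=> // -[i|i] u; rewrite KW /=; first by rewrite inE.
    by rewrite padK ?(arity_le (inr i)).
  apply: (noK K Kker) => -[[| |[i|i] b|q] u] //; rewrite KW /= => /eqP.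
  (* A false bit has its negative literal in the kernel, and [chi] takes opposite values on the two
     literals. *)
  case: b => [-> //|E _]; have := chiN (TLit (inl i) true, u) isT.
  by rewrite E.
case=> X1 HX1.
apply: (colorable_kernel conflict_sym conflict_irr guessed_opposite
   (conflict_Top T0) (hit_Top ^~ T0) erefl).
exists (fun v => if v.1 is TLit (inl i) b then (cut _ v.2 \in X1 i) == b else false).
  by case=> -[| |[i|i] []|q] u //= _; case: (_ \in _).
move=> K Kker Kchi.
pose X2 : relations a2 n.+2 := fun i => [set u | (TLit (inr i) true, pad u) \in K].
suff /(kernel_sat Kker)/negP : compatible (expand (expand A X1) X2) (mem K) by apply.
split=> // -[i|i] u /=; last by rewrite inE.
have [cK _] := kernel_consistent Kker.
have [/Kchi/(_ isT)/=|nK] := boolP ((_, _) \in K).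
  by rewrite padK ?(arity_le (inl i)) // => /eqP.
have /Kchi/(_ isT) /= : (TLit (inl i) false, pad u) \in K.
  by have := consistent_Lit (inl i) (pad u) false cK => /= ->.
by rewrite padK ?(arity_le (inl i)) // => /eqP.
Qed.

End Model.

End Gates.

(** * Definability of the adjacency by literals *)

Definition lift_ren k k' (f : 'I_k -> 'I_k') (i : 'I_k.+1) : 'I_k'.+1 :=
  if unlift ord0 i is Some j then lift ord0 (f j) else ord0.

Definition term_ren (s : vocabulary) k k' (f : 'I_k -> 'I_k') (t : term s k) : term s k' :=
  match t with
  | TVar i => TVar (f i) | TCst c => TCst c
  | TZero => TZero | TOne => TOne | TMax => TMax
  end.

Fixpoint formula_ren (s : vocabulary) k (phi : formula s k) {struct phi} :
    forall k', ('I_k -> 'I_k') -> formula s k' :=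
  match phi in formula _ k return forall k', ('I_k -> 'I_k') -> formula s k' with
  | FRel _ r ts => fun _ f => FRel r [tuple of map (term_ren f) ts]
  | FEq _ t u => fun _ f => FEq (term_ren f t) (term_ren f u)
  | FLe _ t u => fun _ f => FLe (term_ren f t) (term_ren f u)
  | FSuc _ t u => fun _ f => FSuc (term_ren f t) (term_ren f u)
  | FBit _ t u => fun _ f => FBit (term_ren f t) (term_ren f u)
  | FPlus _ t u v => fun _ f => FPlus (term_ren f t) (term_ren f u) (term_ren f v)
  | FTimes _ t u v => fun _ f => FTimes (term_ren f t) (term_ren f u) (term_ren f v)
  | FNot _ g => fun _ f => FNot (formula_ren g f)
  | FAnd _ g h => fun _ f => FAnd (formula_ren g f) (formula_ren h f)
  | FOr _ g h => fun _ f => FOr (formula_ren g f) (formula_ren h f)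
  | FExists _ g => fun _ f => FExists (formula_ren g (lift_ren f))
  | FForall _ g => fun _ f => FForall (formula_ren g (lift_ren f))
  end.

Definition subenv (T : Type) k k' (f : 'I_k -> 'I_k') (e : k'.-tuple T) : k.-tuple T :=
  [tuple tnth e (f i) | i < k].

Lemma subenv_lift (T : Type) k k' (f : 'I_k -> 'I_k') (e : k'.-tuple T) x :
  subenv (lift_ren f) [tuple of x :: e] = [tuple of x :: subenv f e].
Proof.
apply: eq_from_tnth => i; rewrite tnth_mktuple /lift_ren.
case: unliftP => [j ->|->]; first by rewrite !tnthS tnth_mktuple.
by rewrite !tnth0.
Qed.

Lemma sat_ren (s : vocabulary) n (A : structure s n.+2) k (phi : formula s k) k'
    (f : 'I_k -> 'I_k') (e : k'.-tuple 'I_n.+2) :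
  sat A (formula_ren phi f) e = sat A phi (subenv f e).
Proof.
have T k1 k2 (g : 'I_k1 -> 'I_k2) e1 (t : term s k1) :
    teval A e1 (term_ren g t) = teval A (subenv g e1) t.
  by case: t => //= i; rewrite tnth_mktuple.
elim: phi k' f e => {k} /=.
- move=> k r ts k' f e.
  have E : map_tuple (teval A e) (map_tuple (term_ren f) ts) =
           map_tuple (teval A (subenv f e)) ts.
    by apply: val_inj; rewrite /= -map_comp; apply: eq_map => t; rewrite /= T.
  exact: (congr1 (fun u => u \in srel A r) E).
- by move=> *; rewrite !T.
- by move=> *; rewrite !T.
- by move=> *; rewrite !T.
- by move=> *; rewrite !T.
- by move=> *; rewrite !T.
- by move=> *; rewrite !T.
- by move=> k g IH k' f e; rewrite IH.
- by move=> k g IHg h IHh k' f e; rewrite IHg IHh.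
- by move=> k g IHg h IHh k' f e; rewrite IHg IHh.
- by move=> k g IH k' f e; apply: eq_existsb => x; rewrite IH subenv_lift.
- by move=> k g IH k' f e; apply: eq_forallb => x; rewrite IH subenv_lift.
Qed.

Section Definability.

Variables (s : vocabulary) (k : nat).

Local Notation pred_family := (forall n, structure s n.+2 -> k.-tuple 'I_n.+2 -> bool).

(** One formula serves all sizes and structures. It is kept as data, since [projective_cases]
    collects such formulas into a list. *)
Definition numeric_def (P : pred_family) : Type :=
  {a : numeric k | forall n (A : structure s n.+2) e, num_sat a e = P n A e}.

Definition literal_def (P : pred_family) : Type :=
  {l : literal s k | forall n (A : structure s n.+2) e, lit_sat A l e = P n A e}.

Definition simple_def (P : pred_family) : Type := (numeric_def P + literal_def P)%type.

Lemma eq_numeric_def P Q :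
  (forall n A e, P n A e = Q n A e) -> numeric_def P -> numeric_def Q.
Proof. by move=> PQ [a Ha]; exists a => n A e; rewrite (Ha n A e). Qed.

Lemma eq_simple_def P Q :
  (forall n A e, P n A e = Q n A e) -> simple_def P -> simple_def Q.
Proof.
move=> PQ [H|[l Hl]]; first by left; apply: eq_numeric_def H.
by right; exists l => n A e; rewrite Hl.
Qed.

Lemma numeric_def_bool b : numeric_def (fun _ _ _ => b).
Proof.
by case: b; [exists (FEq TZero TZero)|exists (FNot (FEq TZero TZero))] => n A e;
  rewrite /num_sat /= ?eqxx.
Qed.

Lemma numeric_def_neg P : numeric_def P -> numeric_def (fun n A e => ~~ P n A e).
Proof. by move=> [a Ha]; exists (FNot a) => n A e; rewrite -Ha. Qed.

Lemma numeric_def_and P Q :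
  numeric_def P -> numeric_def Q -> numeric_def (fun n A e => P n A e && Q n A e).
Proof. by move=> [a Ha] [b Hb]; exists (FAnd a b) => n A e; rewrite -Ha -Hb. Qed.

Lemma numeric_def_or P Q :
  numeric_def P -> numeric_def Q -> numeric_def (fun n A e => P n A e || Q n A e).
Proof. by move=> [a Ha] [b Hb]; exists (FOr a b) => n A e; rewrite -Ha -Hb. Qed.

Lemma numeric_def_forall (T : finType) (P : T -> pred_family) :
  (forall x, numeric_def (P x)) -> numeric_def (fun n A e => [forall x, P x n A e]).
Proof.
move=> HP.
suff H (r : seq T) : numeric_def (fun n A e => all (fun x => P x n A e) r).
  apply: eq_numeric_def (H (enum T)) => n A e.
  by apply/allP/forallP => [Pr x|Pr x _]; [apply: Pr; rewrite mem_enum|apply: Pr].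
elim: r => [|x r IH] /=; first exact: numeric_def_bool.
exact: numeric_def_and.
Qed.

Lemma numeric_def_eq (i j : 'I_k) : numeric_def (fun n A e => tnth e i == tnth e j).
Proof. by exists (FEq (TVar i) (TVar j)). Qed.

Lemma numeric_def_zero (i : 'I_k) : numeric_def (fun n A e => tnth e i == ord0).
Proof. by exists (FEq (TVar i) TZero). Qed.

Lemma numeric_def_ren k' (a : numeric k') (f : 'I_k' -> 'I_k) :
  numeric_def (fun n A e => num_sat a (subenv f e)).
Proof. by exists (formula_ren a f) => n A e; rewrite /num_sat sat_ren. Qed.

Lemma simple_def_neg P : simple_def P -> simple_def (fun n A e => ~~ P n A e).
Proof.
move=> [/numeric_def_neg H|[l Hl]]; first by left.
right; exists (~~ l.1, l.2) => n A e; rewrite -Hl /lit_sat /=.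
by case: (atom_sat _ _ _); case: (l.1).
Qed.

(** The cases with a numeric definition are merged into the base formula; each other case pairs the
    numeric test [f = i] with its literal. Exclusivity holds because [f] has a single value. *)
Lemma projective_cases (I : finType) (f : forall n, k.-tuple 'I_n.+2 -> I) (P : I -> pred_family) :
  (forall i, numeric_def (fun n A e => f n e == i)) -> (forall i, simple_def (P i)) ->
  exists p : projective s k, forall n (A : structure s n.+2) e,
    proj_sat A p e = P (f n e) n A e.
Proof.
move=> g H.
pose isnum i := if H i is inl _ then true else false.
pose h i := if H i is inr l then Some (sval (g i), sval l) else None.
have [b Hb] : numeric_def (fun n A e => isnum (f n e) && P (f n e) n A e).
  apply: (@eq_numeric_def (fun n A e => ~~ [forall i, ~~ [&& f n e == i, isnum i & P i n A e]])).
    move=> n A e; rewrite negb_forall; apply/existsP/andP => [[i]|[nf Pf]].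
      by rewrite negbK => /and3P[/eqP->].
    by exists (f n e); rewrite negbK eqxx nf.
  apply/numeric_def_neg/numeric_def_forall => i; apply: numeric_def_neg.
  apply: numeric_def_and (g i) _; rewrite /isnum.
  by case: (H i) => [Pi|_] //=; apply: numeric_def_bool.
have hP i : if isnum i then h i = None else
    exists2 l, h i = Some (sval (g i), l) &
      forall n (A : structure s n.+2) e, lit_sat A l e = P i n A e.
  by rewrite /h /isnum; case: (H i) => // -[l Hl]; exists l.
clearbody isnum h.
have gE i n (A : structure s n.+2) e : num_sat (sval (g i)) e = (f n e == i).
  exact: (svalP (g i) n A).
have cnt n (A : structure s n.+2) (e : k.-tuple 'I_n.+2) r :
    count (fun a : numeric k => num_sat a e) [seq c.1 | c <- pmap h r] =
    if isnum (f n e) then 0 else count_mem (f n e) r.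
  elim: r => [|i r IH] /=; first by rewrite if_same.
  have := hP i; case: ifP => ni; [move=> -> /=|case=> l -> _ /=].
    by rewrite IH; have [iE|_] := eqVneq i (f n e); rewrite ?add0n // -iE ni.
  rewrite (gE i n A) IH eq_sym.
  by have [<-|_] := eqVneq i (f n e); rewrite ?add0n // ni.
have hasE n (A : structure s n.+2) (e : k.-tuple 'I_n.+2) r :
    has (fun c : numeric k * literal s k => num_sat c.1 e && lit_sat A c.2 e) (pmap h r) =
    [&& ~~ isnum (f n e), P (f n e) n A e & f n e \in r].
  elim: r => [|i r IH] /=; first by rewrite !andbF.
  rewrite inE; have := hP i; case: ifP => ni; [move=> -> /=|case=> l -> Hl /=].
    by rewrite IH; have [->|_] := eqVneq (f n e) i; rewrite ?ni.
  rewrite (gE i n A) IH Hl.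
  by have [->|_] := eqVneq (f n e) i; rewrite ?ni //= ?andbT; case: (P _ _ _ _).
have excl n (e : k.-tuple 'I_n.+2) :
    count (fun a => num_sat a e) (b :: [seq c.1 | c <- pmap h (enum I)]) <= 1.
  (* Exclusivity concerns numeric formulas only, so the characterisations may be applied with an
     arbitrary structure. *)
  have A : structure s n.+2 by exact (Structure (fun=> set0) (fun=> ord0)).
  rewrite /= (cnt n A) (Hb n A); case: (isnum _); first by rewrite addn0 leq_b1.
  by rewrite (count_uniq_mem _ (enum_uniq _)) leq_b1.
exists (Projective excl) => n A e; rewrite /proj_sat /= hasE (Hb n A) mem_enum andbT.
by case: (isnum _); rewrite /= ?orbF ?andbT.
Qed.

End Definability.

Section AdjacencyDefinability.

Variables (s : vocabulary) (a1 a2 : seq nat) (d : nat) (L : seq (instr s a1 a2 d)).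
Variable k : nat.

Local Notation rels := ('I_(size a1) + 'I_(size a2))%type.
Local Notation gtag := (gate_tag rels (size L)).

Lemma numeric_def_agree (f f' : 'I_d.+1 -> 'I_k) (Q : pred 'I_d.+1) :
  @numeric_def s k (fun n A e =>
    [forall q, Q q ==> (tnth (subenv f e) q == tnth (subenv f' e) q)]).
Proof.
apply: (@numeric_def_forall s k _
  (fun q n A e => Q q ==> (tnth (subenv f e) q == tnth (subenv f' e) q))) => q.
case: (Q q); last by apply: (eq_numeric_def _ (numeric_def_bool s k true)).
apply: eq_numeric_def (numeric_def_eq s (f q) (f' q)) => n A e.
by rewrite !tnth_mktuple.
Qed.

Lemma numeric_def_eq_env (f f' : 'I_d.+1 -> 'I_k) :
  @numeric_def s k (fun n A e => subenv f e == subenv f' e).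
Proof.
apply: eq_numeric_def (numeric_def_agree f f' xpredT) => n A e.
apply/forallP/eqP => [H|-> q]; last by rewrite /= eqxx.
by apply: eq_from_tnth => q; exact/eqP/H.
Qed.

Lemma numeric_def_eq_pad (f f' : 'I_d.+1 -> 'I_k) j (pos : j.-tuple 'I_d.+1) :
  @numeric_def s k (fun n A e =>
    subenv f' e == pad d (proj_env (subenv f e) pos)).
Proof.
pose P (q : 'I_d.+1) n (A : structure s n.+2) (e : k.-tuple 'I_n.+2) :=
  tnth (subenv f' e) q == tnth (pad d (proj_env (subenv f e) pos)) q.
apply: (@eq_numeric_def s k (fun n A e => [forall q, P q n A e])) => [n A e|].
  apply/forallP/eqP => [H|E q]; last by rewrite /P E eqxx.
  by apply: eq_from_tnth => q; exact/eqP/H.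
apply: numeric_def_forall => q; case: (ltnP q j) => qj.
  apply: eq_numeric_def (numeric_def_eq s (f' q) (f (tnth pos (Ordinal qj)))) => n A e.
  rewrite /P !tnth_mktuple -[q : nat]/(Ordinal qj : nat) -tnth_nth.
  by rewrite tnth_map tnth_mktuple.
apply: eq_numeric_def (numeric_def_zero s (f' q)) => n A e.
by rewrite /P !tnth_mktuple nth_default // size_tuple.
Qed.

Variables (f f' : 'I_d.+1 -> 'I_k).

(** The input is consulted only to decide whether [TTrue] is a child. *)
Lemma numeric_def_instr_child (I : instr s a1 a2 d) (x : gtag) : x != TTrue ->
  @numeric_def s k (fun n A e => instr_child A I (subenv f e) x (subenv f' e)).
Proof.
have F := numeric_def_bool s k false.
case: I => [a|r pos|R pos|c p|i j|p i]; case: x => [| |R' b|q] //= _.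
- do 2!apply: numeric_def_and (numeric_def_bool _ _ _) _; exact: numeric_def_eq_pad.
- apply: numeric_def_and (numeric_def_bool _ _ _) _; exact: numeric_def_eq_env.
- apply: numeric_def_and (numeric_def_bool _ _ _) _.
  apply: eq_numeric_def (numeric_def_agree f f' (fun q => q != p)) => n A e.
  by apply: eq_forallb.
Qed.

Lemma numeric_def_child (x y : gtag) : y != TTrue ->
  @numeric_def s k (fun n A e => child A (x, subenv f e) (y, subenv f' e)).
Proof.
move=> yT; have F := numeric_def_bool s k false.
case: x => [| |R b|i] //; last exact: numeric_def_instr_child.
apply: eq_numeric_def (numeric_def_and (numeric_def_bool s k (y == TLit R (~~ b)))
  (numeric_def_eq_env f' f)) => n A e.
by [].
Qed.

Lemma simple_def_child (x y : gtag) :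
  @simple_def s k (fun n A e => child A (x, subenv f e) (y, subenv f' e)).
Proof.
have [->|yT] := eqVneq y TTrue; last by left; apply: numeric_def_child.
have F := numeric_def_bool s k false.
case: x => [| |R b|i] //; [by left|by left|by left|rewrite /child /=].
case: (nth_instr L i) => [a|r pos|R pos|c p|j j'|p j] /=; try by left.
- by left; apply: numeric_def_neg; apply: numeric_def_ren.
(* The arc is present when the input atom fails, hence the negative literal. *)
- right; exists (false, IRel r [tuple of map (fun p => inl (f p)) pos]) => n A e.
  have E : map_tuple (ieval A e) (map_tuple (fun p => inl (f p)) pos) =
           proj_env (subenv f e) pos.
    by apply: val_inj; rewrite /= -map_comp; apply: eq_map => q; rewrite /= tnth_mktuple.
  by rewrite /lit_sat eqbF_neg; apply: (congr1 (fun u => u \notin srel A r) E).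
- right; exists (false, IEq (inr c) (inl (f p))) => n A e.
  by rewrite /lit_sat /= eqbF_neg tnth_mktuple.
Qed.

Lemma numeric_def_eq_gate (x y : gtag) :
  @numeric_def s k (fun n A e => (x, subenv f e) == (y, subenv f' e)).
Proof.
exact: (numeric_def_and (numeric_def_bool s k (x == y)) (numeric_def_eq_env f f')).
Qed.

End AdjacencyDefinability.

Section KernelAdjacencyDefinability.

Variables (s : vocabulary) (a1 a2 : seq nat) (d : nat) (L : seq (instr s a1 a2 d)).
Variables (o : 'I_(size L)) (k : nat) (f f' : 'I_d.+1 -> 'I_k).

Local Notation rels := ('I_(size a1) + 'I_(size a2))%type.
Local Notation gtag := (gate_tag rels (size L)).

(** Only an arc into [TTrue] depends on the input, and [TTrue] has no children; so at most one of
    the two arcs of a conflict needs a literal. *)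
Lemma simple_def_conflict (x y : gtag) :
  @simple_def s k (fun n A e =>
    ((x, subenv f e) != (y, subenv f' e)) &&
    ~~ conflict A (x, subenv f e) (y, subenv f' e)).
Proof.
have [->|xT] := eqVneq x TTrue.
  have [->|yT] := eqVneq y TTrue.
    left; apply: eq_numeric_def (numeric_def_neg (numeric_def_eq_gate f f' TTrue TTrue)) => n A e.
    by rewrite andbT.
  apply: eq_simple_def (simple_def_neg (simple_def_child f' f y TTrue)) => n A e.
  by rewrite /conflict /=; case: eqP => // -[/eqP]; rewrite eq_sym (negbTE yT).
have [->|yT] := eqVneq y TTrue.
  apply: eq_simple_def (simple_def_neg (simple_def_child f f' x TTrue)) => n A e.
  by rewrite /conflict orbF; case: eqP => // -[/eqP]; rewrite (negbTE xT).
left; apply: numeric_def_and; first exact/numeric_def_neg/numeric_def_eq_gate.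
by apply/numeric_def_neg/numeric_def_or; apply: numeric_def_child.
Qed.

Lemma simple_def_hit (x y : gtag) :
  @simple_def s k (fun n A e =>
    ~~ hit o A (x, subenv f e) (y, subenv f' e)).
Proof.
apply: simple_def_neg; rewrite /hit /=.
have [_|xT] := eqVneq x TTop; first by left; apply: numeric_def_bool.
have [->|yT] := eqVneq y TTrue; last first.
  left; apply: numeric_def_or; last exact: numeric_def_child.
  exact: (numeric_def_eq_gate f' f y x).
have [->|xT'] := eqVneq x TTrue.
  left; apply: eq_numeric_def (numeric_def_eq_gate f' f TTrue TTrue) => n A e.
  by rewrite orbF.
apply: eq_simple_def (simple_def_child f f' x TTrue) => n A e.
by case: eqP => // -[/eqP]; rewrite eq_sym (negbTE xT').
Qed.

Lemma numeric_def_opposite (x y : gtag) :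
  @numeric_def s k (fun n A e =>
    (y, subenv f' e) == opposite (x, subenv f e)).
Proof. by case: x => *; apply: (numeric_def_eq_gate f' f). Qed.

Lemma numeric_def_guessed (x : gtag) :
  @numeric_def s k (fun n A e => guessed (x, subenv f e)).
Proof. by case: x => [| |[R|R] b|q]; apply: numeric_def_bool. Qed.

End KernelAdjacencyDefinability.

Lemma simple_def_adj (s : vocabulary) (a1 a2 : seq nat) d (L : seq (instr s a1 a2 d))
    (o : 'I_(size L)) k (f f' : 'I_d.+1 -> 'I_k) (r q : role)
    (x y : gate_tag ('I_(size a1) + 'I_(size a2))%type (size L)) :
  @simple_def s k (fun n A e =>
    kernel_adj (conflict A) (hit o A) (@guessed _ _ _ _ L n) (@opposite _ _ _ _ L n)
      (r, (x, subenv f e)) (q, (y, subenv f' e))).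
Proof.
have C b := numeric_def_bool s k b.
case: r; case: q => /=; try by left; apply: C.
- exact: simple_def_conflict.
- by left; apply: numeric_def_eq_gate.
- exact: simple_def_hit.
- by left; apply: numeric_def_eq_gate.
- by left; apply: numeric_def_and; [apply: numeric_def_guessed|apply: numeric_def_opposite].
- exact: simple_def_hit.
Qed.

(** * The projection *)

(** There are finitely many zero patterns [g], so the condition is a finite disjunction over those
    with [F g = u]. *)
Lemma numeric_def_code (s : vocabulary) k (T U : finType) (pos : T -> 'I_k)
    (F : {ffun T -> bool} -> U) (u : U) :
  @numeric_def s k (fun n A e => F [ffun x => tnth e (pos x) != ord0] == u).
Proof.
pose P g n (A : structure s n.+2) (e : k.-tuple 'I_n.+2) :=
  ~~ ((F g == u) && [forall x, (tnth e (pos x) != ord0) == g x]).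
apply: (@eq_numeric_def s k (fun n A e => ~~ [forall g, P g n A e])) => [n A e|].
  rewrite negb_forall; apply/existsP/eqP => [[g]|FE].
    rewrite negbK => /andP[/eqP<- /forallP gE]; congr F; apply/ffunP=> x.
    by rewrite ffunE; exact: (eqP (gE x)).
  exists [ffun x => tnth e (pos x) != ord0]; rewrite negbK FE eqxx.
  by apply/forallP=> x; rewrite ffunE.
apply/numeric_def_neg/numeric_def_forall => g; apply: numeric_def_neg.
apply: numeric_def_and (numeric_def_bool _ _ _) _.
apply: (@numeric_def_forall s k T (fun x n A e => (tnth e (pos x) != ord0) == g x)) => x.
case: (g x).
  by apply: eq_numeric_def (numeric_def_neg (numeric_def_zero s (pos x))) => n A e; rewrite eqb_id.
by apply: eq_numeric_def (numeric_def_zero s (pos x)) => n A e; rewrite eqbF_neg negbK.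
Qed.

Section Halves.

Variables (T : Type) (k : nat).

Lemma left_pos_subproof (i : 'I_k) : i < 2 * k.
Proof. by rewrite mul2n -addnn ltn_addr. Qed.

Lemma right_pos_subproof (i : 'I_k) : k + i < 2 * k.
Proof. by rewrite mul2n -addnn ltn_add2l. Qed.

Definition left_pos (i : 'I_k) : 'I_(2 * k) := Ordinal (left_pos_subproof i).
Definition right_pos (i : 'I_k) : 'I_(2 * k) := Ordinal (right_pos_subproof i).

Lemma tnth_flatten_left (u v : k.-tuple T) i :
  tnth (flatten_tuple [tuple u; v]) (left_pos i) = tnth u i.
Proof.
have x0 := tnth u i; rewrite !(tnth_nth x0) /=.
by rewrite nth_cat size_tuple ltn_ord.
Qed.

Lemma tnth_flatten_right (u v : k.-tuple T) i :
  tnth (flatten_tuple [tuple u; v]) (right_pos i) = tnth v i.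
Proof.
have x0 := tnth u i; rewrite !(tnth_nth x0) /=.
by rewrite nth_cat size_tuple ltnNge leq_addr addKn cats0.
Qed.

End Halves.

Section Decoding.

Variables (K : finType) (k0 : K) (d n : nat).

(** With one coordinate per element, tested against zero, [K] is coded in the same way over every
    universe, even one of two elements. *)
Definition unary_code (g : {ffun K -> bool}) : K := odflt k0 [pick x | g x].

Definition decode (w : (#|K| + d).-tuple 'I_n.+2) : K * d.-tuple 'I_n.+2 :=
  (unary_code [ffun x => tnth w (lshift d (enum_rank x)) != ord0],
   subenv (@rshift #|K| d) w).

Lemma decode_surj (x : K) (t : d.-tuple 'I_n.+2) : exists w, decode w = (x, t).
Proof.
exists [tuple match split j with
  | inl i => if i == enum_rank x then ord_max else ord0
  | inr q => tnth t q end | j < #|K| + d].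
congr (_, _); last first.
  by apply: eq_from_tnth => q; rewrite !tnth_mktuple -[rshift _ _]/(unsplit (inr q)) unsplitK.
rewrite /unary_code; case: pickP => [y|/(_ x)]; rewrite ffunE tnth_mktuple.
  rewrite -[lshift _ _]/(unsplit (inl (enum_rank y))) unsplitK.
  rewrite (inj_eq enum_rank_inj); have [-> //|_] := eqVneq y x; by rewrite eqxx.
by rewrite -[lshift _ _]/(unsplit (inl (enum_rank x))) unsplitK eqxx.
Qed.

End Decoding.

Lemma lexicographic_enumeration (N n k : nat) : n.+2 = #|{: k.-tuple 'I_N.+2}| ->
  exists f : 'I_n.+2 -> k.-tuple 'I_N.+2,
    (forall i j : 'I_n.+2, i < j -> ((f i : k.-tuplelexi 'I_N.+2) < f j)%O) /\
    (forall b, exists i, f i = b).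
Proof.
move=> E; pose T : finType := k.-tuplelexi 'I_N.+2.
exists (fun i => @Order.enum_val _ (k.-tuplelexi 'I_N.+2) predT (cast_ord E i)); split.
  move=> i j ij.
  have lem := @Order.le_enum_val _ (k.-tuplelexi 'I_N.+2) (@Order.TotalTheory.le_total _ _) predT.
  by rewrite (Order.POrderTheory.leW_mono lem).
move=> b; exists (cast_ord (esym E) (@Order.enum_rank _ (k.-tuplelexi 'I_N.+2) b)).
by rewrite cast_ordKV Order.EnumVal.enum_rankK.
Qed.

(** The numeric case distinction is on the pair of decoded kinds; once these are fixed,
    [simple_def_adj] leaves at most one literal. *)
Lemma edge_projective (s : vocabulary) (a1 a2 : seq nat) d (L : seq (instr s a1 a2 d))
    (o : 'I_(size L)) (K : finType) (k0 : K)
    (f : K -> role * gate_tag ('I_(size a1) + 'I_(size a2))%type (size L)) :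
  exists p : projective s (2 * (#|K| + d.+1)), forall n (A : structure s n.+2) u v,
    proj_sat A p (flatten_tuple [tuple u; v]) =
    kernel_adj (conflict A) (hit o A) (@guessed _ _ _ _ L n) (@opposite _ _ _ _ L n)
      (let: (x, t) := decode k0 u in ((f x).1, ((f x).2, t)))
      (let: (x, t) := decode k0 v in ((f x).1, ((f x).2, t))).
Proof.
pose code (side : 'I_(#|K| + d.+1) -> 'I_(2 * (#|K| + d.+1))) n
    (e : (2 * (#|K| + d.+1)).-tuple 'I_n.+2) : K :=
  unary_code k0 [ffun x => tnth e (side (lshift d.+1 (enum_rank x))) != ord0].
pose envpos (side : 'I_(#|K| + d.+1) -> 'I_(2 * (#|K| + d.+1))) (q : 'I_d.+1) :=
  side (@rshift #|K| d.+1 q).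
pose P (xy : K * K) n (A : structure s n.+2) (e : (2 * (#|K| + d.+1)).-tuple 'I_n.+2) :=
  kernel_adj (conflict A) (hit o A) (@guessed _ _ _ _ L n) (@opposite _ _ _ _ L n)
    ((f xy.1).1, ((f xy.1).2, subenv (envpos (@left_pos _)) e))
    ((f xy.2).1, ((f xy.2).2, subenv (envpos (@right_pos _)) e)).
have [|xy|p Hp] := @projective_cases s _ _
    (fun n e => (code (@left_pos _) n e, code (@right_pos _) n e)) P.
- move=> [x y]; apply: (@eq_numeric_def s _
    (fun n A e => (code (@left_pos _) n e == x) && (code (@right_pos _) n e == y))) => //.
  by apply: numeric_def_and; apply: numeric_def_code.
- exact: simple_def_adj.
exists p => n A u v; rewrite Hp /P /decode /=.
have codeE side w : (forall i, tnth (flatten_tuple [tuple u; v]) (side i) = tnth w i) ->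
    code side n (flatten_tuple [tuple u; v]) =
    unary_code k0 [ffun x => tnth w (lshift d.+1 (enum_rank x)) != ord0].
  by move=> E; congr unary_code; apply/ffunP=> x; rewrite !ffunE E.
have envE side w : (forall i, tnth (flatten_tuple [tuple u; v]) (side i) = tnth w i) ->
    subenv (envpos side) (flatten_tuple [tuple u; v]) = subenv (@rshift #|K| d.+1) w.
  by move=> E; apply: eq_from_tnth => q; rewrite !tnth_mktuple E.
have El := @tnth_flatten_left _ _ u v; have Er := @tnth_flatten_right _ _ u v.
by rewrite !(codeE _ _ El) !(codeE _ _ Er) !(envE _ _ El) !(envE _ _ Er).
Qed.

Lemma sigma2_reducible (s : vocabulary) (S : problem s) n0 :
  Sigma2p s S -> fop_reducible S (add_small two_CC n0).
Proof.
move=> [a1 [a2 [phi Sphi]]].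
pose ar (R : 'I_(size a1) + 'I_(size a2)) := arity (so_sym s R).
(* The summands leave room for the reserved positions and quantified variables, for every padded
   tuple, and for an image of size above [n0], where [add_small] changes nothing. *)
pose d := 3 + #|csym s| + quant_depth phi + \max_R ar R + n0.
have base_le : 3 + #|csym s| + quant_depth phi <= d.+1 by rewrite /d -!addnA -addnS; lia.
have arity_le (R : 'I_(size a1) + 'I_(size a2)) : arity (so_sym s R) <= d.+1.
  have : ar R <= \max_R ar R by apply: leq_bigmax.
  by rewrite /d -/(ar R); move: (_ + quant_depth phi) (bigop _ _ _) => q M; lia.
have [L [acL [i0 i0L Hout]]] := sentence_circuit base_le.
pose o := Ordinal i0L.
pose K : finType := (role * gate_tag ('I_(size a1) + 'I_(size a2))%type (size L))%type.
pose k0 : K := (Lit, TTop).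
have [p Hp] := edge_projective o k0 (fun x : K => x).
pose k := #|K| + d.+1.
pose I : fop s graph_voc := @Fop s graph_voc k (FEq TZero TZero)
  (fun=> p) (fun c => match c with end).
exists I => m A.
have card_big : 2 + n0 < #|{: k.-tuple 'I_m.+2}|.
  rewrite card_tuple card_ord; apply: (@leq_trans (2 ^ k)); last first.
    by apply: leq_exp2r; rewrite /k addnS.
  apply: leq_ltn_trans (ltn_expl _ _) => //; rewrite /k /d; lia.
have [n nE] : exists n, n.+2 = #|{: k.-tuple 'I_m.+2}|.
  by exists (#|{: k.-tuple 'I_m.+2}| - 2); lia.
have [f [flt fsurj]] := lexicographic_enumeration nE.
pose B : structure graph_voc n.+2 := @Structure graph_voc n.+2
  (fun=> [set v : 2.-tuple 'I_n.+2 | proj_sat A p (flatten_tuple [tuple of map f v])])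
  (fun c => match c with end).
exists n, B; split.
  exists f; split; [exact: flt| | |by case].
    by move=> b; split=> // _; exact: fsurj.
  by case=> v; rewrite inE.
pose dec (w : k.-tuple 'I_m.+2) :
    role * (gate_tag ('I_(size a1) + 'I_(size a2))%type (size L) * d.+1.-tuple 'I_m.+2) :=
  let: (x, t) := decode k0 w in (x.1, (x.2, t)).
pose adj := kernel_adj (conflict A) (hit o A) (@guessed _ _ _ _ L m) (@opposite _ _ _ _ L m).
have edgeE u v : edge B u v = adj (dec (f u)) (dec (f v)).
  rewrite /edge inE /adj /dec -Hp; congr (proj_sat _ _ (flatten_tuple _)).
  exact: val_inj.
have adj_sym : symmetric adj.
  apply: kernel_adj_sym; [exact: conflict_sym|exact: oppositeK|exact: guessed_opposite].
have adj_irr : irreflexive adj by apply: kernel_adj_irr; apply: opposite_neq.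
have dec_surj y : exists u, dec (f u) = y.
  case: y => r [x t]; have [w wE] := decode_surj k0 ((r, x) : K) t.
  by have [u uE] := fsurj w; exists u; rewrite /dec uE wE.
have colorE : clique_colorable (edge B) <-> clique_colorable adj.
  have := clique_colorable_twins adj_irr dec_surj => -[H1 H2].
  split=> [H|/H2]; last by apply: eq_clique_colorable => u v; rewrite edgeE.
  by apply: H1; apply: eq_clique_colorable H.
have simpleB : simple_graph B.
  by split=> [u v|u]; rewrite !edgeE; [apply: adj_sym|apply: adj_irr].
have base_le' : 3 + #|csym s| <= d.+1 by apply: leq_trans base_le; apply: leq_addr.
have phiE := @colorable_sigma2 s a1 a2 d L o acL arity_le m A phi base_le' (Hout m).
rewrite Sphi -phiE.
split=> [/colorE H|[/two_CC_colorable[_ /colorE] //|]].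
  by left; apply/two_CC_colorable.
by rewrite ltnNge nE ltnW // (leq_ltn_trans _ card_big) // leq_addl.
Qed.

(** * Membership *)

Section Membership.

Local Notation voc := (ext_voc (ext_voc graph_voc [:: 1]) [:: 1]).

Definition edge_formula k (i j : 'I_k) : formula voc k :=
  @FRel voc k (inl (inl tt)) [tuple TVar i; TVar j].

Definition color_formula k (i : 'I_k) : formula voc k :=
  @FRel voc k (inl (inr ord0)) [tuple TVar i].

Definition set_formula k (i : 'I_k) : formula voc k :=
  @FRel voc k (inr ord0) [tuple TVar i].

(** The bound [j] is a fixed number, so the comparison is unfolded into at most [j] steps through
    predecessors. *)
Fixpoint lt_formula j : forall k, formula voc k.+1 :=
  match j with
  | 0 => fun k => FNot (FEq TZero TZero)
  | j'.+1 => fun k => FOr (FEq (TVar ord0) TZero)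
      (FExists (FAnd (FSuc (TVar ord0) (TVar (lift ord0 ord0))) (lt_formula j' k.+1)))
  end.

(** The largest element is the size minus one, hence [j.-1]. *)
Definition size_lt_formula j : formula voc 0 :=
  FExists (FAnd (FEq (TVar ord0) TMax) (lt_formula j.-1 0)).

Definition simple_formula : formula voc 0 :=
  FAnd (FForall (FForall (FOr (FNot (edge_formula (inord 1) (inord 0)))
                              (edge_formula (inord 0) (inord 1)))))
       (FForall (FNot (edge_formula ord0 ord0))).

Definition max_clique_formula : formula voc 0 :=
  FAnd (FForall (FForall (FOr (FNot (set_formula (inord 1)))
         (FOr (FNot (set_formula (inord 0)))
         (FOr (FEq (TVar (inord 1)) (TVar (inord 0))) (edge_formula (inord 1) (inord 0)))))))
       (FForall (FOr (set_formula ord0)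
         (FExists (FAnd (set_formula (inord 0)) (FNot (edge_formula (inord 0) (inord 1))))))).

Definition bichromatic_formula : formula voc 0 :=
  FAnd (FExists (FAnd (set_formula ord0) (color_formula ord0)))
       (FExists (FAnd (set_formula ord0) (FNot (color_formula ord0)))).

Definition two_CC_formula j : formula voc 0 :=
  FOr (size_lt_formula j)
      (FAnd simple_formula (FOr (FNot max_clique_formula) bichromatic_formula)).

Variables (n : nat) (B : structure voc n.+2).
Variables (adj : rel 'I_n.+2) (col : pred 'I_n.+2) (K : {set 'I_n.+2}).
Hypothesis adjE : forall x y, ([tuple x; y] \in @srel voc _ B (inl (inl tt))) = adj x y.
Hypothesis colE : forall x, ([tuple x] \in @srel voc _ B (inl (inr ord0))) = col x.
Hypothesis memE : forall x, ([tuple x] \in @srel voc _ B (inr ord0)) = (x \in K).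

(** One-step rewriting rules, which unlike simplification keep the atomic formulas folded. *)
Lemma sat_connectives :
  ((forall k (f : formula voc k) e, sat B (FNot f) e = ~~ sat B f e) *
   (forall k (f g : formula voc k) e, sat B (FAnd f g) e = sat B f e && sat B g e) *
   (forall k (f g : formula voc k) e, sat B (FOr f g) e = sat B f e || sat B g e) *
   (forall k (t u : term voc k) e, sat B (FEq t u) e = (teval B e t == teval B e u)) *
   (forall k (f : formula voc k.+1) e,
      sat B (FExists f) e = [exists x, sat B f [tuple of x :: e]]) *
   (forall k (f : formula voc k.+1) e,
      sat B (FForall f) e = [forall x, sat B f [tuple of x :: e]]))%type.
Proof. by []. Qed.

Let S := sat_connectives.

Lemma sat_edge k (e : k.-tuple 'I_n.+2) i j :
  sat B (edge_formula i j) e = adj (tnth e i) (tnth e j).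
Proof.
have E : map_tuple (teval B e) [tuple TVar i; TVar j] = [tuple tnth e i; tnth e j].
  exact: val_inj.
by rewrite -adjE; apply: (congr1 (fun t => t \in @srel voc _ B (inl (inl tt))) E).
Qed.

Lemma sat_color k (e : k.-tuple 'I_n.+2) i :
  sat B (color_formula i) e = col (tnth e i).
Proof.
have E : map_tuple (teval B e) [tuple TVar i] = [tuple tnth e i] by exact: val_inj.
by rewrite -colE; apply: (congr1 (fun t : 1.-tuple _ => t \in @srel voc _ B (inl (inr ord0))) E).
Qed.

Lemma sat_set k (e : k.-tuple 'I_n.+2) i :
  sat B (set_formula i) e = (tnth e i \in K).
Proof.
have E : map_tuple (teval B e) [tuple TVar i] = [tuple tnth e i] by exact: val_inj.
by rewrite -memE; apply: (congr1 (fun t : 1.-tuple _ => t \in @srel voc _ B (inr ord0)) E).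
Qed.

Lemma sat_lt j k (e : k.+1.-tuple 'I_n.+2) : sat B (lt_formula j k) e = (tnth e ord0 < j).
Proof.
elim: j k e => [|j IH] k e /=; first by rewrite ltn0.
apply/orP/idP => [[/eqP-> //|/existsP[x]]|].
  by rewrite IH tnthS !tnth0 => /andP[/eqP<-].
case E: (tnth e ord0 : nat) => [|x] xj; first by left; apply/eqP/val_inj.
right; have xn : x < n.+2 by rewrite ltnW // -E ltn_ord.
by apply/existsP; exists (Ordinal xn); rewrite IH tnthS !tnth0 /= E eqxx.
Qed.

Lemma sat_size_lt j : sat B (size_lt_formula j) [tuple] = (n.+2 < j).
Proof.
rewrite /size_lt_formula S; apply/existsP/idP => [[x]|jn]; last exists ord_max;
  rewrite !S sat_lt /= tnth0.
  by case/andP=> /eqP-> /=; case: j.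
by rewrite eqxx; case: j jn.
Qed.

Lemma tnth_pair0 (T : Type) (x y : T) : tnth [tuple x; y] (inord 0) = x.
Proof. by rewrite (tnth_nth x) /= inordK. Qed.

Lemma tnth_pair1 (T : Type) (x y : T) : tnth [tuple x; y] (inord 1) = y.
Proof. by rewrite (tnth_nth x) /= inordK. Qed.

Let E := (tnth_pair0, tnth_pair1, tnth0, sat_edge, sat_set, sat_color).

Lemma sat_simple :
  reflect (symmetric adj /\ irreflexive adj) (sat B simple_formula [tuple]).
Proof.
rewrite /simple_formula !S; apply: (iffP andP) => -[sym irr]; split.
- suff imp x y : adj x y -> adj y x by move=> x y; apply/idP/idP; apply: imp.
  move: sym => /forallP/(_ x); rewrite S => /forallP/(_ y); rewrite !S !E.
  by case/orP=> // /negP.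
- by move=> x; move: irr => /forallP/(_ x); rewrite !S !E => /negbTE.
- apply/forallP=> x; rewrite S; apply/forallP=> y; rewrite !S !E.
  by rewrite sym orNb.
- by apply/forallP=> x; rewrite !S !E irr.
Qed.

Lemma sat_max_clique : sat B max_clique_formula [tuple] = max_clique adj K.
Proof.
rewrite /max_clique_formula !S; apply/andP/max_cliqueP => -[H1 H2]; split.
- move=> x y xK yK xy; move: H1 => /forallP/(_ x); rewrite S => /forallP/(_ y).
  by rewrite !S /teval !E xK yK (negbTE xy).
- move=> v vK; move: H2 => /forallP/(_ v); rewrite !S !E (negbTE vK) orFb => /existsP[u].
  by rewrite !S !E => /andP[uK uv]; exists u.
- apply/forallP=> x; rewrite S; apply/forallP=> y; rewrite !S /teval !E.
  case xK: (x \in K) => //=; case yK: (y \in K) => //=.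
  by have [//|xy] := eqVneq x y; apply: H1.
apply/forallP=> v; rewrite !S !E.
case: (boolP (v \in K)) => [//|/H2[u uK uv]]; rewrite orFb; apply/existsP; exists u.
by rewrite !S !E uK.
Qed.

Lemma sat_bichromatic : reflect (exists x y, [/\ x \in K, y \in K, col x & ~~ col y])
  (sat B bichromatic_formula [tuple]).
Proof.
rewrite /bichromatic_formula !S.
apply: (iffP andP) => [[/existsP[x +] /existsP[y +]]|[x [y [xK yK cx cy]]]].
  by rewrite !S !E => /andP[xK cx] /andP[yK cy]; exists x, y.
by split; apply/existsP; [exists x|exists y]; rewrite !S !E ?xK ?yK.
Qed.

Lemma sat_two_CC j : sat B (two_CC_formula j) [tuple] =
  (n.+2 < j) || sat B simple_formula [tuple] &&
    (max_clique adj K ==> sat B bichromatic_formula [tuple]).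
Proof.
rewrite implybE -sat_max_clique -sat_size_lt //.
Qed.

End Membership.

(** [has P] reads the single entry without converting the arity, which reduces to 1 only for a
    concrete [i]. *)
Definition unary_relation m (P : pred 'I_m) : relations [:: 1] m :=
  fun i => [set t : (nth 0 [:: 1] i).-tuple 'I_m | has P t].

(** The existential relation is a colour class and the universal one a candidate maximal clique. *)
Lemma two_CC_Sigma2p j : Sigma2p graph_voc (add_small two_CC j).
Proof.
exists [:: 1], [:: 1], (two_CC_formula j) => n G.
rewrite /add_small two_CC_colorable /sigma2_models.
have colE (P : pred 'I_n.+2) x : ([tuple x] \in unary_relation P ord0) = P x.
  by rewrite inE /= orbF.
pose setof (X : relations [:: 1] n.+2) : {set 'I_n.+2} :=
  [set x | ([tuple x] : 1.-tuple 'I_n.+2) \in X ord0].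
have setofE (X : relations [:: 1] n.+2) x :
    (([tuple x] : 1.-tuple 'I_n.+2) \in X ord0) = (x \in setof X).
  by rewrite inE.
have satE X1 X2 := @sat_two_CC n (expand (expand G X1) X2) (edge G) (setof X2)
  (fun x y => erefl) (setofE X2) j.
have simpleE X1 X2 := @sat_simple n (expand (expand G X1) X2) (edge G) (fun x y => erefl).
have bichrE X1 X2 := @sat_bichromatic n (expand (expand G X1) X2)
  (fun x => ([tuple x] : 1.-tuple 'I_n.+2) \in X1 ord0) (setof X2)
  (fun x => erefl) (setofE X2).
split.
  case=> [[simG [c Hc]]|small].
    exists (unary_relation c) => X2; rewrite satE; apply/orP; right; apply/andP; split.
      exact/simpleE.
    apply/implyP=> /Hc[x [y [xK yK cx cy]]]; apply/bichrE; exists x, y.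
    by split=> //; rewrite colE.
  by exists (unary_relation xpredT) => X2; rewrite satE small.
case=> X1 HX1.
have [small|nsmall] := boolP (n.+2 < j); [by right|left].
split.
  (* Simplicity does not mention the candidate clique, so any set extracts it. *)
  have := HX1 (unary_relation xpredT); rewrite satE (negbTE nsmall) => /andP[/simpleE//].
exists (fun x => ([tuple x] : 1.-tuple 'I_n.+2) \in X1 ord0) => K maxK.
have := HX1 (unary_relation (mem K)); rewrite satE (negbTE nsmall) => /andP[_].
have -> : setof (unary_relation (mem K)) = K.
  by apply/setP=> x; rewrite inE colE.
rewrite maxK => /bichrE[x [y [xK yK cx cy]]]; exists x, y; split=> //.
  by move: xK; rewrite inE colE.
by move: yK; rewrite inE colE.
Qed.

(** * Universality *)

Definition touched m t (L : conjunction m t) : {set 'I_m} :=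
  [set v in [seq l.1.2 | l <- L] ++ [seq l.2 | l <- L]].

Lemma card_touched m t (L : conjunction m t) : #|touched L| <= 2 * t.
Proof.
apply: leq_trans (_ : size ([seq l.1.2 | l <- L] ++ [seq l.2 | l <- L]) <= _).
  by rewrite cardsE; apply: card_size.
by rewrite size_cat !size_map size_tuple mul2n addnn.
Qed.

(* The vertices occurring in the literals are joined to all the others and only
   carry the edges required among themselves: with the two sides as colours,
   every clique extends across. *)
Lemma two_CC_universal t : 0 < t -> universal two_CC (2 * t).+2 t.
Proof.
move=> t_gt0 m tm L [G0 [[sym0 irr0] G0L]].
pose T := touched L.
pose req x y := (true, x, y) \in L.
pose adj x y := [|| req x y, req y x | (x \in T) (+) (y \in T)].
have reqP x y : req x y -> edge G0 x y by move/G0L.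
pose G : structure graph_voc m.+2 := @Structure graph_voc m.+2
  (fun=> [set v : 2.-tuple 'I_m.+2 | adj (tnth v ord0) (tnth v ord_max)])
  (fun c => match c with end).
have GE x y : edge G x y = adj x y.
  by rewrite /edge inE !(tnth_nth x).
have touchedL b x y : (b, x, y) \in L -> (x \in T) && (y \in T).
  move=> bL; rewrite !inE !mem_cat; apply/andP; split; apply/orP.
    by left; apply: (map_f (fun l => l.1.2) bL).
  by right; apply: (map_f (fun l => l.2) bL).
have [v vT] : exists v, v \in T.
  case E: (tnth L (Ordinal t_gt0)) => [[b x] y]; exists x.
  by have := mem_tnth (Ordinal t_gt0) L; rewrite E => /touchedL/andP[].
(* At most [2 * t] vertices occur in [L], fewer than the [m.+2] available. *)
have [w wT] : exists w, w \notin T.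
  apply/existsP; rewrite -negb_forall; apply/negP=> /forallP allT.
  have := card_touched L; rewrite -/T (eq_card (fun x => allT x)) card_ord.
  by move=> H; have := leq_trans tm H; lia.
exists G; split; last first.
  case=> [[b x] y] bL; rewrite GE /=; have /andP[xT yT] := touchedL _ _ _ bL.
  rewrite /adj xT yT orbF; case: b bL => bL; first by rewrite /req bL.
  apply/negP=> /orP[]/reqP; first by rewrite (G0L _ bL).
  by rewrite sym0 (G0L _ bL).
apply/two_CC_colorable; split.
  split=> [x y|x]; rewrite !GE /adj; first by rewrite addbC orbCA.
  by rewrite addbb orbF orbb; apply/negP=> /reqP; rewrite irr0.
exists (mem T) => K /max_cliqueP[_ Kmax].
(* Vertices on different sides are adjacent, so a vertex of [K] excluding [z] lies on the side of
   [z]; thus [K] meets both sides. *)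
have side u z : ~~ edge G u z -> (u \in T) = (z \in T).
  by rewrite GE /adj !negb_or => /and3P[_ _]; case: (u \in T); case: (z \in T).
have inK z : exists2 u, u \in K & (u \in T) = (z \in T).
  have [zK|/Kmax[u uK /side uz]] := boolP (z \in K); first by exists z.
  by exists u.
have [x xK xT] := inK v; have [y yK yT] := inK w.
by exists x, y; rewrite /= xT yT.
Qed.

Theorem theorem3 : complete_universal Sigma2p (trunc_family two_CC).
Proof.
split=> [_ [n _ ->]|].
  split=> [|s S]; first exact: two_CC_Sigma2p.
  exact: sigma2_reducible.
(* The size exceeds the number of vertices that [t] literals can mention, and [t >= 1] ensures that
   some vertex is mentioned. *)
exists (fun t => (2 * t).+2), 1 => t t_gt0.
exists (add_small two_CC (2 * t).+2); split=> [||n A small]; last by right.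
- by exists (2 * t).+2.
- move=> m tm L /(two_CC_universal t_gt0 tm)[G [GCC GL]].
  by exists G; split=> //; left.
Qed.
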